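(* The LJ-homology of a contact manifold is trivial: if $(M,\eta)$ is a contact manifold with associated Jacobi structure $(\Lambda,E)$, then $H_k^{LJ}(M)=\{0\}$ for all $k$.
   Context: Manifolds are smooth and connected. $\Omega^k(M)$ denotes the space of $k$-forms on $M$ (zero for $k<0$). A contact manifold $(M,\eta)$ of dimension $2m+1$ is a manifold with a 1-form $\eta$ such that $\eta\wedge(d\eta)^m\neq0$ at every point. Its associated Jacobi structure is the 2-vector $\Lambda$ and vector field $E$ given by $\Lambda(\alpha,\beta)=d\eta(\flat^{-1}(\alpha),\flat^{-1}(\beta))$, $E=\flat^{-1}(\eta)$, where $\flat:\mathfrak X(M)\to\Omega^1(M)$ is the isomorphism $\flat(X)=i_Xd\eta+\eta(X)\eta$. The Lichnerowicz-Jacobi (LJ) homology $H_*^{LJ}(M)$ is the homology of the complex $(\Omega^*(M)\oplus\Omega^{*-1}(M),\delta)$, where for $(\alpha,\beta)\in\Omega^k(M)\oplus\Omega^{k-1}(M)$ $$\delta(\alpha,\beta)=\big(i(\Lambda)d\alpha-d\,i(\Lambda)\alpha+k\,i_E\alpha+(-1)^k\mathcal L_E\beta,\ i(\Lambda)d\beta-d\,i(\Lambda)\beta+(k-1)i_E\beta+(-1)^ki(\Lambda)\alpha\big)\in\Omega^{k-1}(M)\oplus\Omega^{k-2}(M),$$ with $i(\Lambda)$ the contraction by $\Lambda$, $i(X\wedge Y)\alpha=\alpha(X,Y,\cdot,\dots,\cdot)$; it satisfies $\delta^2=0$. *)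

(* Defs.v *)
From HB Require Import structures.
From mathcomp Require Import all_boot all_order all_algebra all_fingroup.
From mathcomp Require Import all_classical all_reals all_analysis.

Set Implicit Arguments.
Unset Strict Implicit.
Unset Printing Implicit Defensive.

Import Order.TTheory GRing.Theory Num.Theory.
Import numFieldNormedType.Exports.

Local Open Scope classical_set_scope.
Local Open Scope ring_scope.

Fixpoint class_C {R : realType} {n : nat} {W : normedModType R} (k : nat)
    (V : set 'rV[R]_n) (f : 'rV[R]_n -> W) : Prop :=
  match k with
  | 0 => forall x, V x -> {for x, continuous f}
  | k'.+1 => (forall x, V x -> differentiable f x) /\
             (forall v, class_C k' V (fun x => 'D_v f x))
  end.

(* Meaningful for open V. *)
Definition smooth_on {R : realType} {n : nat} {W : normedModType R}
    (V : set 'rV[R]_n) (f : 'rV[R]_n -> W) : Prop :=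
  forall k, class_C k V f.

(* A smooth connected n-manifold (Hausdorff, second countable), given by a
   smooth, not necessarily maximal, atlas.  The values of coord c outside
   dom c and of coord_inv c outside coord c @` dom c are irrelevant. *)
Record manifold (R : realType) (n : nat) (M : topologicalType) := Manifold {
  chart : Type;
  dom : chart -> set M;
  coord : chart -> M -> 'rV[R]_n;
  coord_inv : chart -> 'rV[R]_n -> M;
  dom_open : forall c, open (dom c);
  dom_cover : \bigcup_c dom c = [set: M];
  codom_open : forall c, open (coord c @` dom c);
  coordK : forall c p, dom c p -> coord_inv c (coord c p) = p;
  coord_continuous : forall c, {within dom c, continuous (coord c)};
  coord_inv_continuous :
    forall c, {within coord c @` dom c, continuous (coord_inv c)};
  transition_smooth : forall c c',
    smooth_on (coord c @` (dom c `&` dom c')) (coord c' \o coord_inv c);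
  manifold_hausdorff : hausdorff_space M;
  manifold_second_countable : @second_countable M;
  manifold_connected : connected [set: M]
}.

Section Tensors.
Context {R : realType} {n : nat} {M : topologicalType} (A : manifold R n M).

Definition cdom (c : chart A) : set 'rV[R]_n := coord c @` dom c.

Definition transition (c c' : chart A) : 'rV[R]_n -> 'rV[R]_n :=
  coord c' \o coord_inv c.

(* Tensor fields are given by their local expressions in all the charts.
   A differential form a is a family of functions, a c x [:: v1; ..; vk] being
   the value at the point with coordinates x in the chart c on the tangent
   vectors with components v1, .., vk in that chart.  The degree is not part
   of the type: a form of degree k vanishes on sequences of size other than k
   (so that forms of negative degree are zero), and local expressions are
   extended by 0 outside the image of the chart (so that = is equality of
   forms). *)
Definition preform := chart A -> 'rV[R]_n -> seq 'rV[R]_n -> R.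
Definition vfield := chart A -> 'rV[R]_n -> 'rV[R]_n.

(* L c x xi zeta is the value of the 2-vector L on the covectors with
   components xi and zeta. *)
Definition bivector := chart A -> 'rV[R]_n -> 'rV[R]_n -> 'rV[R]_n -> R.

Definition e_ (i : 'I_n) : 'rV[R]_n := delta_mx 0 i.

Definition multilinear (f : seq 'rV[R]_n -> R) : Prop :=
  forall s1 s2 (a : R) u v,
    f (s1 ++ (a *: u + v) :: s2) = a * f (s1 ++ u :: s2) + f (s1 ++ v :: s2).

Definition alternating (f : seq 'rV[R]_n -> R) : Prop :=
  forall s1 s2 s3 u, f (s1 ++ u :: s2 ++ u :: s3) = 0.

Record is_form (k : int) (a : preform) : Prop := IsForm {
  form_supp : forall c x s, ~ cdom c x -> a c x s = 0;
  form_degree : forall c x s, (size s)%:Z != k -> a c x s = 0;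
  form_multilinear : forall c x, multilinear (a c x);
  form_alternating : forall c x, alternating (a c x);
  form_smooth : forall c s, smooth_on (cdom c) (fun x => a c x s : R^o);
  form_compat : forall c c' x s, (coord c @` (dom c `&` dom c')) x ->
    a c x s =
    a c' (transition c c' x) [seq 'D_v (transition c c') x | v <- s]
}.

Definition Omega (k : int) : set preform := [set a | is_form k a].

Definition extd (a : preform) : preform := fun c x s =>
  if x \in cdom c then
    \sum_(i < size s) (-1) ^+ i *
      'D_(nth 0 s i) (fun y => a c y (take i s ++ drop i.+1 s) : R^o) x
  else 0.

Definition interior (X : vfield) (a : preform) : preform :=
  fun c x s => a c x (X c x :: s).

(* X(a(v1, .., vk)) - \sum_i a(v1, .., [X, vi], .., vk) for the constant vector
   fields vi, for which [X, vi] = - 'D_vi X. *)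
Definition lie (X : vfield) (a : preform) : preform := fun c x s =>
  if x \in cdom c then
    'D_(X c x) (fun y => a c y s : R^o) x +
    \sum_(i < size s) a c x (set_nth 0 s i ('D_(nth 0 s i) (X c) x))
  else 0.

(* i(L), for L = \sum_(i < j) L^{ij} e_i /\ e_j, extending
   i(X /\ Y) a = a(X, Y, ..), with
   (X /\ Y)(xi, zeta) = xi(X) zeta(Y) - xi(Y) zeta(X). *)
Definition contract (L : bivector) (a : preform) : preform := fun c x s =>
  \sum_(i < n) \sum_(j < n | (i < j)%N)
    L c x (e_ i) (e_ j) * a c x [:: e_ i, e_ j & s].

(* The summand for k is the component of bidegree (k, size s - k), normalised
   so that (xi /\ zeta)(u, v) = xi(u) zeta(v) - xi(v) zeta(u). *)
Definition wedge (a b : preform) : preform := fun c x s =>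
  \sum_(k < (size s).+1) ((k`! * (size s - k)`!)%N%:R)^-1 *
    \sum_(p : 'S_(size s))
      let t := [seq nth 0 s (p i) | i <- enum 'I_(size s)] in
      (-1) ^+ p * (a c x (take k t) * b c x (drop k t)).

Definition form1 : preform := fun c x s =>
  if (x \in cdom c) && nilp s then 1 else 0.

Definition wedge_pow (a : preform) (m : nat) : preform :=
  iter m (wedge a) form1.

Definition contact_form (m : nat) (eta : preform) : Prop :=
  Omega 1 eta /\
  forall c x, cdom c x ->
    exists s, wedge eta (wedge_pow (extd eta) m) c x s != 0.

(* The components of i_v d eta + eta(v) eta. *)
Definition flat (eta : preform) (c : chart A) (x v : 'rV[R]_n) : 'rV[R]_n :=
  \row_j (extd eta c x [:: v; e_ j] + eta c x [:: v] * eta c x [:: e_ j]).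

(* The inverse of flat, as flat eta c x v = v *m lin1_mx (flat eta c x). *)
Definition sharp (eta : preform) (c : chart A) (x xi : 'rV[R]_n) : 'rV[R]_n :=
  xi *m invmx (lin1_mx (flat eta c x)).

Definition contact_vfield (eta : preform) : vfield := fun c x =>
  sharp eta c x (\row_j eta c x [:: e_ j]).

Definition contact_bivector (eta : preform) : bivector := fun c x xi zeta =>
  extd eta c x [:: sharp eta c x xi; sharp eta c x zeta].

Section LJ.
Variables (L : bivector) (E : vfield).

Definition LJ_chain (k : int) : set (preform * preform) :=
  Omega k `*` Omega (k - 1).

Definition LJ_d (k : int) (z : preform * preform) : preform * preform :=
  let: (a, b) := z in
  ((fun c x s =>
      contract L (extd a) c x s - extd (contract L a) c x s
      + k%:~R * interior E a c x s + (-1) ^ k * lie E b c x s),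
   (fun c x s =>
      contract L (extd b) c x s - extd (contract L b) c x s
      + (k - 1)%:~R * interior E b c x s + (-1) ^ k * contract L a c x s)).

Definition LJ_cycle (k : int) : set (preform * preform) :=
  [set z | LJ_chain k z /\ LJ_d k z = 0].

Definition LJ_boundary (k : int) : set (preform * preform) :=
  LJ_d (k + 1) @` LJ_chain (k + 1).

Definition LJ_class (k : int) (z : preform * preform) :
    set (preform * preform) :=
  [set w | LJ_cycle k w /\ LJ_boundary k (w - z)].

(* The quotient of cycles by boundaries, as a set of classes. *)
Definition LJ_homology (k : int) : set (set (preform * preform)) :=
  LJ_class k @` LJ_cycle k.

End LJ.

End Tensors.

(* Main.v *)
(** Exterior multiplication by eta is, up to a constant, a contracting homotopy.
    Contraction by Lambda commutes with [eta /\ _] because Lambda (eta, .) = 0,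
    and for a of degree k,
    [i(Lambda) (d eta /\ a) = m a - (k a - eta /\ i_E a) + d eta /\ i(Lambda) a].
    Together with i_E eta = 1 and L_E eta = 0 this gives, for
    h (a, b) = (eta /\ a, eta /\ b), the identity delta h + h delta = m + 1, so
    that a cycle z is the boundary of (m + 1)^-1 h z. *)

(* The wedge product is defined by a normalised sum over permutations, whereas the identities above
   isolate one vector at a time. The bridge is that eta /\ a is the alternating sum of the eta(v_i)
   a(.., v_i omitted, ..), written as a recursion on the list of arguments. The exterior derivative
   has the same shape, so the Leibniz rules become inductions on that list, at a point of a chart.
   What concerns Lambda and E is matrix algebra. Let W and eta be the components of d eta and eta.
   Then flat is right multiplication of row vectors by F = W + eta^T eta. Since W is antisymmetric
   of odd size it has a kernel, and invertibility of F makes eta nonzero on it: this gives E. One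
   then finds W Lambda = eta^T E - 1. Its trace is -2m, and m is half of 2m because contraction runs
   over i < j; the same matrix identity, applied to the mixed terms, yields k a - eta /\ i_E a. In
   delta h + h delta the terms d eta /\ i(Lambda) a cancel, and the -k from the contraction meets k
   + 1 from the i_E term of delta: this is why the constant m + 1 does not depend on the degree. *)
Require Import Defs.
From HB Require Import structures.
From mathcomp Require Import all_boot all_order all_algebra all_fingroup.
From mathcomp Require Import all_classical all_reals all_analysis.
From mathcomp Require Import zify ring lra.
Import Order.TTheory GRing.Theory Num.Theory.
Import numFieldNormedType.Exports.
Import Defs.
Local Open Scope classical_set_scope.
Local Open Scope ring_scope.

Set Implicit Arguments.
Unset Strict Implicit.
Unset Printing Implicit Defensive.

(** * Alternating sums and products with 1-forms and 2-forms, by recursion on the arguments *)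

Section AlternatingSums.
Context {R : comNzRingType} {T : Type}.
Implicit Types (s : seq T) (g : seq T -> R) (f : T -> R) (G : T -> seq T -> R).
Implicit Types (w : T -> T -> R) (B : T -> T).

Definition ins v g : seq T -> R := fun s => g (v :: s).

(** Common shape of f /\ g and of the exterior derivative. The recursion hides the signs and the
    deleted index, so that proofs go by induction on the list; [altsumE] recovers the indexed
    sum. *)
Fixpoint altsum G s : R :=
  if s is v :: s' then G v s' - altsum (fun u t => G u (v :: t)) s' else 0.

Lemma altsumE (x0 : T) G s :
  altsum G s =
  \sum_(i < size s) (-1) ^+ i * G (nth x0 s i) (take i s ++ drop i.+1 s).
Proof.
elim: s G => [|v s IH] G /=; first by rewrite big_ord0.
rewrite big_ord_recl /= expr0 mul1r drop0 IH -sumrN; congr (_ + _).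
by apply: eq_bigr => i _; rewrite exprS mulN1r mulNr.
Qed.

Lemma eq_altsum G G' s : G =2 G' -> altsum G s = altsum G' s.
Proof.
by elim: s G G' => [|v s IH] G G' e //=; rewrite e; congr (_ - _); apply: IH.
Qed.

Lemma altsumD G G' s :
  altsum (fun u t => G u t + G' u t) s = altsum G s + altsum G' s.
Proof.
elim: s G G' => [|v s IH] G G' /=; first by rewrite addr0.
by rewrite IH opprD addrACA.
Qed.

Lemma altsumZ (r : R) G s : altsum (fun u t => r * G u t) s = r * altsum G s.
Proof. by elim: s G => [|v s IH] G /=; rewrite ?mulr0 // IH mulrBr. Qed.

Lemma altsum_sum (I : Type) (r : seq I) (P : pred I)
    (G : I -> T -> seq T -> R) s :
  altsum (fun u t => \sum_(i <- r | P i) G i u t) s =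
  \sum_(i <- r | P i) altsum (G i) s.
Proof.
elim: s G => [|v s IH] G /=; first by rewrite big1.
by rewrite IH -sumrB.
Qed.

Definition wedge1 f g : seq T -> R := altsum (fun v t => f v * g t).

Lemma wedge1_cons f g v s :
  wedge1 f g (v :: s) = f v * g s - wedge1 f (ins v g) s.
Proof. by []. Qed.

Lemma eq_wedge1 f f' g g' s : f =1 f' -> g =1 g' ->
  wedge1 f g s = wedge1 f' g' s.
Proof. by move=> ef eg; apply: eq_altsum => u t; rewrite ef eg. Qed.

Lemma wedge1Dl f f' g s :
  wedge1 (fun u => f u + f' u) g s = wedge1 f g s + wedge1 f' g s.
Proof. by rewrite -altsumD; apply: eq_altsum => u t; rewrite mulrDl. Qed.

Lemma wedge1Zl r f g s : wedge1 (fun u => r * f u) g s = r * wedge1 f g s.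
Proof. by rewrite -altsumZ; apply: eq_altsum => u t; rewrite mulrA. Qed.

Lemma wedge1Dr f g g' s :
  wedge1 f (fun u => g u + g' u) s = wedge1 f g s + wedge1 f g' s.
Proof. by rewrite -altsumD; apply: eq_altsum => u t; rewrite mulrDr. Qed.

Lemma wedge1Zr r f g s : wedge1 f (fun u => r * g u) s = r * wedge1 f g s.
Proof. by rewrite -altsumZ; apply: eq_altsum => u t; rewrite mulrCA. Qed.

Lemma wedge1Nl f g s : wedge1 (fun u => - f u) g s = - wedge1 f g s.
Proof.
by rewrite -mulN1r -wedge1Zl; apply: eq_wedge1 => // u; rewrite mulN1r.
Qed.

Lemma wedge1Nr f g s : wedge1 f (fun u => - g u) s = - wedge1 f g s.
Proof.
by rewrite -mulN1r -wedge1Zr; apply: eq_wedge1 => // u; rewrite mulN1r.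
Qed.

Lemma wedge1_sumr (I : Type) (r : seq I) (P : pred I) f
    (g : I -> seq T -> R) s :
  wedge1 f (fun t => \sum_(i <- r | P i) g i t) s =
  \sum_(i <- r | P i) wedge1 f (g i) s.
Proof. by rewrite -altsum_sum; apply: eq_altsum => u t; rewrite mulr_sumr. Qed.

Lemma wedge1_0l f g s : (forall u, f u = 0) -> wedge1 f g s = 0.
Proof.
move=> f0; rewrite -(mul0r (wedge1 f g s)) -wedge1Zl.
by apply: eq_wedge1 => // u; rewrite f0 mulr0.
Qed.

Lemma wedge1_0r f g s : (forall t, g t = 0) -> wedge1 f g s = 0.
Proof.
move=> g0; rewrite -(mul0r (wedge1 f g s)) -wedge1Zr.
by apply: eq_wedge1 => // t; rewrite g0 mulr0.
Qed.

(* The wedge product with a 2-form, expanded along the first vector. *)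
Fixpoint wedge2 w g s : R :=
  if s is v :: s' then wedge1 (w v) g s' + wedge2 w (ins v g) s' else 0.

Lemma eq_wedge2 w w' g g' s : w =2 w' -> g =1 g' ->
  wedge2 w g s = wedge2 w' g' s.
Proof.
move=> ew; elim: s g g' => [|v s IH] g g' e //=.
by congr (_ + _); [apply: eq_wedge1 | apply: IH => t; apply: e].
Qed.

Lemma wedge2Zr w r g s : wedge2 w (fun t => r * g t) s = r * wedge2 w g s.
Proof.
by elim: s g => [|v s IH] g /=; rewrite ?mulr0 // wedge1Zr mulrDr -IH.
Qed.

Lemma wedge2_sumr (I : Type) (r : seq I) (P : pred I) w
    (g : I -> seq T -> R) s :
  wedge2 w (fun t => \sum_(i <- r | P i) g i t) s =
  \sum_(i <- r | P i) wedge2 w (g i) s.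
Proof.
elim: s g => [|v s IH] g /=; first by rewrite big1.
by rewrite wedge1_sumr big_split /= -IH.
Qed.

(* The zeroth-order part of a Lie derivative. *)
Fixpoint derivation B g s : R :=
  if s is v :: s' then g (B v :: s') + derivation B (ins v g) s' else 0.

Lemma derivationE (x0 : T) B g s :
  derivation B g s = \sum_(i < size s) g (set_nth x0 s i (B (nth x0 s i))).
Proof.
elim: s g => [|v s IH] g /=; first by rewrite big_ord0.
by rewrite big_ord_recl /= IH.
Qed.

Lemma eq_derivation B g g' s : g =1 g' -> derivation B g s = derivation B g' s.
Proof.
elim: s g g' => [|v s IH] g g' e //=; rewrite e; congr (_ + _).
by apply: IH => t; apply: e.
Qed.

Lemma derivationD B g g' s :
  derivation B (fun t => g t + g' t) s = derivation B g s + derivation B g' s.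
Proof.
elim: s g g' => [|v s IH] g g' /=; first by rewrite addr0.
by rewrite addrACA -IH.
Qed.

Lemma derivationZ B r g s :
  derivation B (fun t => r * g t) s = r * derivation B g s.
Proof. by elim: s g => [|v s IH] g /=; rewrite ?mulr0 // mulrDr -IH. Qed.

(** Leibniz rule. After the first vector [v] is split off, the two terms pairing [f (B v)] with [g]
    and [f v] with the derivation of [g] match directly; induction handles the rest. *)
Lemma derivation_wedge1 B f g s :
  derivation B (wedge1 f g) s =
  wedge1 (f \o B) g s + wedge1 f (derivation B g) s.
Proof.
elim: s g => [|v s IH] g; first by rewrite /wedge1 /= addr0.
rewrite /= !wedge1_cons.
have -> : derivation B (ins v (wedge1 f g)) s =
    f v * derivation B g s - derivation B (wedge1 f (ins v g)) s.
  rewrite -derivationZ -mulN1r -derivationZ -derivationD.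
  by apply: eq_derivation => t; rewrite /ins wedge1_cons mulN1r.
have -> : wedge1 f (ins v (derivation B g)) s =
    wedge1 f (ins (B v) g) s + wedge1 f (derivation B (ins v g)) s.
  by rewrite -wedge1Dr.
rewrite IH /=; ring.
Qed.

Definition antisymmetric g := forall s1 u v s2,
  g (s1 ++ u :: v :: s2) = - g (s1 ++ v :: u :: s2).

Lemma antisymmetric_ins v g : antisymmetric g -> antisymmetric (ins v g).
Proof. by move=> h s1; apply: (h (v :: s1)). Qed.

(** Moving the i-th vector back from the front to its place costs (-1)^i, which cancels the sign of
    the sum, so all terms equal [g s]. This is the source of the term k a in i(Lambda) (d eta /\
    a). *)
Lemma altsum_antisymmetric g s : antisymmetric g ->
  altsum (fun u t => g (u :: t)) s = (size s)%:R * g s.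
Proof.
elim: s g => [|v s IH] g h /=; first by rewrite mul0r.
have -> : altsum (fun u t => g [:: u, v & t]) s = - ((size s)%:R * g (v :: s)).
  rewrite -(IH (ins v g) (antisymmetric_ins v h)) -mulN1r -altsumZ.
  by apply: eq_altsum => u t; rewrite mulN1r; apply: (h [::]).
by rewrite opprK -natr1 mulrDl mul1r addrC.
Qed.

Lemma antisymmetric_move g s1 u s2 s3 : antisymmetric g ->
  g (s1 ++ u :: s2 ++ s3) = (-1) ^+ size s2 * g (s1 ++ s2 ++ u :: s3).
Proof.
move=> h; elim: s2 s1 => [|v s2 IH] s1 /=; first by rewrite mul1r.
by rewrite h -cat_rcons IH exprS cat_rcons -!mulrA mulN1r.
Qed.

End AlternatingSums.

(** * Behaviour of antisymmetric functions under arbitrary permutations of the arguments *)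

Section AntisymmetricPermutation.
Context {R : comNzRingType} {T : Type}.
Implicit Types (g : seq T -> R).

Lemma antisymmetric_swap g s1 u s2 v s3 : antisymmetric g ->
  g (s1 ++ u :: s2 ++ v :: s3) = - g (s1 ++ v :: s2 ++ u :: s3).
Proof.
move=> h; rewrite (antisymmetric_move _ u s2 _ h).
rewrite [in RHS](antisymmetric_move _ v s2 _ h) -mulrN; congr (_ * _).
by rewrite !catA; apply: h.
Qed.

Lemma antisymmetric_tperm n g (F : 'I_n -> T) (i j : 'I_n) :
  antisymmetric g -> i != j ->
  g [seq F (tperm i j k) | k <- enum 'I_n] = - g [seq F k | k <- enum 'I_n].
Proof.
move=> h ij; have := enum_uniq 'I_n; have := mem_enum 'I_n i.
have := mem_enum 'I_n j; move: (enum _) => l.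
(* The enumeration contains i and j once each, in one order or the other; composing with the
   transposition exchanges exactly these two entries. *)
have swap (a b : 'I_n) l1 l2 l3 : uniq (l1 ++ a :: l2 ++ b :: l3) ->
    g [seq F (tperm a b k) | k <- l1 ++ a :: l2 ++ b :: l3] =
    - g [seq F k | k <- l1 ++ a :: l2 ++ b :: l3].
  rewrite !(cat_uniq, cons_uniq) /= !has_cat /= !mem_cat !inE !negb_or /=.
  case/and3P=> _ /and4P[a1 _ b1 _] /and4P[/and3P[a2 _ a3] _].
  case/andP=> b2 _ /andP[b3 _].
  have id l' : a \notin l' -> b \notin l' ->
      [seq F (tperm a b k) | k <- l'] = [seq F k | k <- l'].
    move=> al bl; apply/eq_in_map => k kl.
    by rewrite tpermD //; [move: al | move: bl]; apply: contraNneq => ->.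
  rewrite !map_cat /= !map_cat /= !id // tpermL tpermR.
  exact: antisymmetric_swap.
move=> /splitPr[l1 l2]; rewrite mem_cat inE (negPf ij) /=.
case/orP=> /splitPr[l3 l4].
  by rewrite -catA cat_cons; apply: swap.
by rewrite tpermC; apply: swap.
Qed.

Lemma antisymmetric_perm n g (F : 'I_n -> T) (p : 'S_n) : antisymmetric g ->
  g [seq F (p k) | k <- enum 'I_n] = (-1) ^+ p * g [seq F k | k <- enum 'I_n].
Proof.
move=> h; have [ts -> ] := prod_tpermP p; elim: ts F => [|[i j] ts IH] F /=.
  rewrite big_nil odd_perm1 mul1r => _; congr g.
  by apply: eq_map => k; rewrite perm1.
case/andP=> ij dts; rewrite big_cons odd_permM odd_tperm ij signr_addb expr1.
rewrite mulN1r mulNr -IH //.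
rewrite -(antisymmetric_tperm (fun k => F ((\prod_(t <- ts) tperm t.1 t.2)%g k))
  h ij).
by congr g; apply: eq_map => k; rewrite permM.
Qed.

End AntisymmetricPermutation.

(** * The wedge product of forms, and its reduction to an alternating sum *)

Section Wedge.
Context {R : realType} {n : nat} {M : topologicalType} {A : manifold R n M}.
Implicit Types (a b : preform A) (c : chart A) (x : 'rV[R]_n).

Lemma multilinearD (f : seq 'rV[R]_n -> R) s1 u v s2 : multilinear f ->
  f (s1 ++ (u + v) :: s2) = f (s1 ++ u :: s2) + f (s1 ++ v :: s2).
Proof. by move=> h; have := h s1 s2 1 u v; rewrite scale1r mul1r. Qed.

Lemma multilinear0 (f : seq 'rV[R]_n -> R) s1 s2 : multilinear f ->
  f (s1 ++ 0 :: s2) = 0.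
Proof.
move=> h; have := multilinearD s1 0 0 s2 h; rewrite addr0 => /eqP.
by rewrite -subr_eq subrr eq_sym => /eqP.
Qed.

Lemma multilinearZ (f : seq 'rV[R]_n -> R) s1 r u s2 : multilinear f ->
  f (s1 ++ r *: u :: s2) = r * f (s1 ++ u :: s2).
Proof. by move=> h; have := h s1 s2 r u 0;
  rewrite addr0 (multilinear0 _ _ h) ?addr0. Qed.

Lemma multilinear_sum (f : seq 'rV[R]_n -> R) s1 s2 (I : Type) (r : seq I)
    (P : pred I) (F : I -> 'rV[R]_n) : multilinear f ->
  f (s1 ++ (\sum_(i <- r | P i) F i) :: s2) =
  \sum_(i <- r | P i) f (s1 ++ F i :: s2).
Proof.
move=> h; elim/big_rec2: _; first exact: multilinear0.
by move=> i y1 y2 _ <-; apply: multilinearD.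
Qed.

Lemma alternating_antisymmetric (f : seq 'rV[R]_n -> R) :
  multilinear f -> alternating f -> antisymmetric f.
Proof.
move=> hm ha s1 u v s2; apply/eqP; rewrite -addr_eq0 -(ha s1 [::] s2 (u + v)).
rewrite /= (multilinearD s1 u v _ hm) -!(cat_rcons _ s1) !(multilinearD _ u v s2
  hm).
rewrite !cat_rcons.
by rewrite (ha s1 [::]) (ha s1 [::]) add0r addr0.
Qed.

(** The type ['S_(size s)] depends on the list; naming the size lets lists of equal length be
    compared over one symmetric group. *)
Lemma wedgeE a b c x s N : size s = N ->
  wedge a b c x s =
  \sum_(k < N.+1) ((k`! * (N - k)`!)%N%:R)^-1 *
    \sum_(p : 'S_N)
      let t := [seq nth 0 s (p i) | i <- enum 'I_N] in
      (-1) ^+ p * (a c x (take k t) * b c x (drop k t)).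
Proof. by move=> <-. Qed.

(** If the vectors at positions i and j agree, composing the permutation with the transposition of i
    and j keeps the arguments and flips the sign. The sum is then its own opposite, whatever [a] and
    [b] are. *)
Lemma wedge_alternating a b c x : alternating (wedge a b c x).
Proof.
move=> s1 s2 s3 u; set s := _ ++ _.
rewrite /wedge big1 // => k _; rewrite -[RHS](mulr0 (((k`! * (size s -
  k)`!)%N%:R)^-1)); congr (_ * _).
have hi : (size s1 < size s)%N by rewrite /s size_cat /= addnS ltnS leq_addr.
have hj : (size s1 + (size s2).+1 < size s)%N.
  by rewrite /s !size_cat /= size_cat /=; lia.
set F := BIG_F.
pose i := Ordinal hi; pose j := Ordinal hj.
have ij : i != j by rewrite -val_eqE /=; apply/eqP; lia.
have nths q : nth 0 s (tperm i j q) = nth 0 s q.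
  have nij : nth 0 s i = nth 0 s j.
    rewrite /s /= !nth_cat ltnn subnn /=.
    by rewrite [X in if X then _ else _]ltnNge leq_addr /= addKn /= nth_cat ltnn
      subnn.
  by case: tpermP => [->|->|] //; rewrite nij.
have e : \sum_p F p = - \sum_p F p.
  rewrite {1}(reindex_inj (mulIg (tperm i j))) /= -sumrN; apply: eq_bigr => p _.
  rewrite /F odd_permM odd_tperm ij /= signr_addb mulrN1 mulNr; congr (- _).
  have -> : [seq nth 0 s ((p * tperm i j)%g q) | q <- enum 'I_(size s)] =
      [seq nth 0 s (p q) | q <- enum 'I_(size s)].
    by apply: eq_map => q; rewrite permM nths.
  by [].
by move: e; move: (\sum_p F p) => X e; lra.
Qed.

Lemma wedge_multilinear a b c x :
  multilinear (a c x) -> multilinear (b c x) -> multilinear (wedge a b c x).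
Proof.
move=> ha hb s1 s2 r u v; pose N := (size s1 + size s2).+1.
have sz w : size (s1 ++ w :: s2) = N by rewrite size_cat /= addnS.
rewrite !(wedgeE _ _ _ _ (sz _)) mulr_sumr -big_split /=; apply: eq_bigr => k _.
rewrite (mulrCA r) -mulrDr; congr (_ * _).
rewrite mulr_sumr -big_split /=; apply: eq_bigr => p _.
rewrite (mulrCA r) -mulrDr; congr (_ * _).
have hi : (size s1 < N)%N by rewrite ltnS leq_addr.
pose i := p^-1%g (Ordinal hi).
(* The varying vector is read only at the index i that p sends to its position, so the surrounding
   lists can be computed with 0 in its place. Depending on k, it then lands among the arguments of
   [b] or of [a]. *)
have [t1 [t2 et]] : exists t1 t2, forall w,
    [seq nth 0 (s1 ++ w :: s2) (p q) | q <- enum 'I_N] = t1 ++ w :: t2.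
  have := mem_enum 'I_N i; have := enum_uniq 'I_N.
  move: (enum _) => l /[swap] /splitPr[l1 l2].
  rewrite cat_uniq cons_uniq /= => /and3P[_ /norP[i1 _] /andP[i2 _]].
  exists [seq nth 0 (s1 ++ 0 :: s2) (p q) | q <- l1].
  exists [seq nth 0 (s1 ++ 0 :: s2) (p q) | q <- l2] => w.
  have id l' : i \notin l' -> [seq nth 0 (s1 ++ w :: s2) (p q) | q <- l'] =
      [seq nth 0 (s1 ++ 0 :: s2) (p q) | q <- l'].
    move=> il; apply/eq_in_map => q ql; rewrite !nth_cat.
    case: ltngtP => // [lt|e]; first by rewrite -(subnSK lt).
    have : q = i by rewrite /i -(permK p q); congr (_ _); apply: val_inj.
    by move=> qi; move: il; rewrite -qi ql.
  rewrite map_cat /= !id // /i permKV /= nth_cat ltnn subnn //.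
rewrite !et !take_cat !drop_cat; case: ltnP => [_|le]; first by rewrite hb;
  ring.
case: (k - size t1)%N => [|q]; first by rewrite /= (hb [::]); ring.
by rewrite /= ha; ring.
Qed.

Lemma lift_perm_inj N (i j : 'I_N.+1) : injective (lift_perm i j).
Proof.
move=> q q' e; apply/permP => k; apply: (@lift_inj _ j).
by rewrite -!(lift_perm_lift i) e.
Qed.

(** Deleting i from the source and j from the target of p leaves the required q. With injectivity,
    the permutations with p i = j are reindexed by the smaller symmetric group. *)
Lemma lift_perm_onto N (i j : 'I_N.+1) (p : 'S_N.+1) :
  p i = j -> exists q, lift_perm i j q = p.
Proof.
move=> pij; pose h k := odflt k (unlift j (p (lift i k))).
have hE k : lift j (h k) = p (lift i k).
  rewrite /h; have : j != p (lift i k) by rewrite -pij (inj_eq perm_inj)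
    neq_lift.
  by move=> /unlift_some[q -> ->].
have h_inj : injective h.
  by move=> k k' e; apply: (@lift_inj _ i); apply: (@perm_inj _ p);
    rewrite -!hE e.
exists (perm h_inj); apply/permP => k; case: (unliftP i k) => [k'|] ->.
  by rewrite lift_perm_lift permE hE.
by rewrite lift_perm_id.
Qed.

(** Only the bidegree with one vector in [a] survives. Group the permutations by i = p 0: each is
    the lift of a permutation of the N other positions, with extra sign (-1)^i, and antisymmetry of
    [b] makes the N! terms of a group equal, which cancels the normalisation 1/(1! N!). *)
Lemma wedge_wedge1 a b c x s :
  (forall t, size t != 1%N -> a c x t = 0) -> antisymmetric (b c x) ->
  wedge a b c x s = wedge1 (fun v => a c x [:: v]) (b c x) s.
Proof.
move=> ha hb; case e: (size s) => [|N].
  rewrite (size0nil e) /wedge1 /= (wedgeE _ _ _ _ (N := 0)) // big_ord1.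
  by rewrite big1 ?mulr0 // => p _; rewrite /= take0 ha // mul0r mulr0.
rewrite (wedgeE _ _ _ _ e) /wedge1 (altsumE 0) e.
have h1 : (1 < N.+2)%N by [].
rewrite (bigD1 (Ordinal h1)) //= [X in _ + X]big1 ?addr0; last first.
  move=> k hk; rewrite big1 ?mulr0 // => p _; rewrite ha ?mul0r ?mulr0 //.
  by rewrite size_takel // size_map size_enum_ord -ltnS.
rewrite (partition_big (fun p : 'S_N.+1 => p ord0) xpredT) //= mulr_sumr.
apply: eq_bigr => i _.
pose s' := take i s ++ drop i.+1 s.
have szs' : size s' = N.
  by rewrite size_cat size_drop size_takel ?e; have := ltn_ord i; lia.
have nths' j : nth 0 s' j = nth 0 s (bump i j).
  have szi : size (take i s) = i by rewrite size_takel // e ltnW.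
  rewrite nth_cat szi /bump.
  case: ltnP => [lt|le]; first by rewrite nth_take.
  by rewrite nth_drop; congr (nth _ _ _); lia.
rewrite (reindex (lift_perm ord0 i)); last first.
  exists (fun p => odflt 1%g [pick q | lift_perm ord0 i q == p]).
    move=> q _; case: pickP => [q' /eqP /lift_perm_inj //|/(_ q)].
    by rewrite eqxx.
  move=> p /eqP /lift_perm_onto[q qp].
  by case: pickP => [q' /eqP //|/(_ q)]; rewrite qp eqxx.
rewrite (eq_bigl xpredT); last by move=> p; rewrite lift_perm_id eqxx.
rewrite (eq_bigr (fun=> (-1) ^+ i * (a c x [:: nth 0 s i] * b c x s'))).
  rewrite sumr_const card_Sn -[_ *+ N`!]mulr_natl.
  rewrite (_ : 1`! = 1)%N // mul1n subSS subn0 mulKf ?pnatr_eq0 -?lt0n ?fact_gt0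
    //.
move=> p _; rewrite odd_lift_perm /= signr_addb signr_odd.
rewrite enum_ordSl /= lift_perm_id -map_comp /= take0 drop0.
have -> : [seq nth 0 s (lift_perm ord0 i p (lift ord0 q)) | q <- enum 'I_N] =
    [seq nth 0 s' (p q) | q <- enum 'I_N].
  by apply: eq_map => q; rewrite lift_perm_lift nths'.
rewrite (antisymmetric_perm (fun q : 'I_N => nth 0 s' q)) //.
have -> : [seq nth 0 s' (q : 'I_N) | q <- enum 'I_N] = s'.
  by rewrite (map_comp (nth 0 s') val) val_enum_ord -szs' -/(mkseq _ _)
    mkseq_nth.
by rewrite (mulrCA (a c x _)) -mulrA signrMK.
Qed.

End Wedge.

(** * Linear algebra of a contact structure at one point *)

Section ContactLinearAlgebra.
Context {R : realType} {n : nat}.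
Implicit Types (u v : 'rV[R]_n) (g : seq 'rV[R]_n -> R).

(** Singularity gives a linear relation among the vectors. Solve it for one with nonzero coefficient
    and substitute: every term of the expansion repeats a vector. *)
Lemma alternating_singular g s : multilinear g -> alternating g ->
  \det (\matrix_(i < n) nth 0 s i) = 0 -> size s = n -> g s = 0.
Proof.
move=> hm ha /eqP/det0P[u /eqP u0 uT] sz.
have [i ui] : exists i, u 0 i != 0.
  apply/existsP; apply: contra_notT u0; rewrite negb_exists => /forallP h.
  by apply/rowP => i; rewrite mxE; apply/eqP; have := h i; rewrite negbK.
have is_ : (i < size s)%N by rewrite sz.
have sE : s = take i s ++ nth 0 s i :: drop i.+1 s.
  by rewrite -drop_nth // cat_take_drop.
apply: (mulfI ui); rewrite mulr0 {1}sE -(multilinearZ _ _ _ _ hm).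
have -> : u 0 i *: nth 0 s i = - \sum_(j < n | j != i) u 0 j *: nth 0 s j.
  apply/eqP; rewrite -addr_eq0; apply/eqP.
  transitivity (\sum_(j < n) u 0 j *: nth 0 s j);
    first by rewrite [RHS](bigD1 i).
  rewrite -[RHS]uT; apply/rowP => k; rewrite !mxE summxE; apply: eq_bigr => j _.
  by rewrite !mxE.
rewrite -scaleN1r (multilinearZ _ _ _ _ hm) (multilinear_sum _ _ _ _ _ hm).
rewrite big1 ?mulr0 // => j ji; rewrite (multilinearZ _ _ _ _ hm).
have js : nth 0 s j \in take i s ++ drop i.+1 s.
  have js : (j < size s)%N by rewrite sz.
  rewrite mem_cat; case: (ltngtP j i) => [lt|lt|/val_inj/eqP]; last first.
  - by rewrite (negPf ji).
  - apply/orP; right; rewrite -(subnKC lt) -nth_drop; apply: mem_nth.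
    by rewrite size_drop ltn_sub2r //; apply: leq_ltn_trans js.
  - apply/orP; left; rewrite -(nth_take _ lt); apply: mem_nth.
    by rewrite size_takel // ltnW.
move: js; rewrite mem_cat => /orP[] /splitPr[s1 s2].
  by rewrite -catA cat_cons ha mulr0.
by rewrite ha mulr0.
Qed.

Lemma det_antisymmetric_odd (W : 'M[R]_n) : odd n -> W^T = - W -> \det W = 0.
Proof.
move=> on hW; have := det_tr W; rewrite hW -scaleN1r detZ -signr_odd on => h.
by move: h; move: (\det W) => d h; lra.
Qed.

Section Contact.
Variables (W : 'M[R]_n) (eta : 'rV[R]_n).
Hypotheses (n_odd : odd n) (W_antisym : W^T = - W).
Let F := W + eta^T *m eta.
Hypothesis F_unit : F \in unitmx.
Let S := invmx F.

(** With [W] and [eta] the components of d eta and eta, this is flat^-1(eta), and the entries of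
    [jacobi_mx] are the d eta(flat^-1(e_i), flat^-1(e_j)), that is, the components of Lambda. *)
Definition reeb_row := eta *m invmx (W + eta^T *m eta).
Definition jacobi_mx :=
  invmx (W + eta^T *m eta) *m W *m (invmx (W + eta^T *m eta))^T.

Let E := reeb_row.
Let L := jacobi_mx.

(** Take v != 0 in the kernel of [W]. Then v F = eta(v) eta, and eta(v) != 0 because F is
    invertible; hence E is v / eta(v). *)
Lemma reeb_rowP : E *m W = 0 /\ E *m eta^T = 1%:M.
Proof.
have /eqP/det0P[v v0 vW] := det_antisymmetric_odd n_odd W_antisym.
pose r := (v *m eta^T) 0 0.
have vF : v *m F = r *: eta.
  by rewrite mulmxDr vW add0r mulmxA [v *m _]mx11_scalar mul_scalar_mx.
have r0 : r != 0.
  apply: contra_neq v0 => r0; rewrite -(mulmxK F_unit v) vF r0.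
  by rewrite scale0r mul0mx.
have eE : E = r^-1 *: v.
  by rewrite /E /reeb_row -/F -[eta](scalerK r0) -vF -scalemxAl mulmxK.
rewrite eE -!scalemxAl vW scaler0; split=> //.
by rewrite [v *m _]mx11_scalar -/r scale_scalar_mx mulVf.
Qed.

Let mulSF : S *m F = 1%:M. Proof. exact: mulVmx. Qed.

Lemma jacobi_mx_tr : L^T = - L.
Proof. by rewrite /L /jacobi_mx !trmx_mul trmxK W_antisym mulNmx mulmxN mulmxA.
  Qed.

(** Transposing F only changes the sign of [W], which E kills, so E F^T is still eta. *)
Let etaST : eta *m S^T = E.
Proof.
have [EW Eeta] := reeb_rowP.
have <- : E *m F^T = eta.
  rewrite /F linearD /= W_antisym trmx_mul trmxK mulmxDr mulmxN EW oppr0 add0r.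
  by rewrite mulmxA Eeta mul1mx.
by rewrite -mulmxA -trmx_mul mulSF trmx1 mulmx1.
Qed.

(** Replacing the middle factor [W] by F - eta^T eta makes L affine in the inverse of F; products of
    L with eta and [W] can then be read off. *)
Let jacobi_mxE : L = S^T - E^T *m E.
Proof.
have -> : L = S *m F *m S^T - S *m eta^T *m (eta *m S^T).
  have WF : W = F - eta^T *m eta by rewrite addrK.
  by rewrite /L /jacobi_mx -/F -/S [in LHS]WF mulmxBr mulmxBl !mulmxA.
by rewrite mulSF mul1mx etaST -etaST trmx_mul trmxK.
Qed.

Lemma mul_eta_jacobi : eta *m L = 0.
Proof.
have [EW Eeta] := reeb_rowP.
rewrite jacobi_mxE mulmxBr etaST mulmxA -[eta *m E^T]trmxK trmx_mul trmxK Eeta.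
by rewrite trmx1 mul1mx subrr.
Qed.

(** On a row vector this reads v W L = eta(v) E - v: up to sign, Lambda inverts d eta on the kernel
    of eta. *)
Lemma mul_W_jacobi : W *m L = eta^T *m E - 1%:M.
Proof.
have [EW Eeta] := reeb_rowP.
have WE : W *m E^T = 0.
  by rewrite -[W]trmxK W_antisym -trmx_mul mulmxN EW oppr0 trmx0.
rewrite jacobi_mxE mulmxBr mulmxA WE mul0mx subr0.
have -> : W = eta^T *m eta - F^T.
  rewrite /F linearD /= W_antisym trmx_mul trmxK opprD opprK.
  by rewrite addrCA subrr addr0.
by rewrite mulmxBl -mulmxA etaST -trmx_mul mulSF trmx1.
Qed.

(** By antisymmetry the sum is -tr(W L) = n - tr(eta^T E), and tr(eta^T E) = eta(E) = 1. *)
Lemma sum_jacobi_W : \sum_i \sum_j L i j * W i j = n.-1%:R.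
Proof.
have [EW Eeta] := reeb_rowP.
have -> : \sum_i \sum_j L i j * W i j = - \tr (W *m L).
  rewrite /mxtrace exchange_big -sumrN /=; apply: eq_bigr => j _.
  rewrite mxE -sumrN; apply: eq_bigr => i _.
  have := congr1 (fun X : 'M[R]_n => X i j) W_antisym; rewrite !mxE => ->.
  by rewrite mulNr opprK mulrC.
rewrite mul_W_jacobi linearB /= mxtrace_mulC Eeta !mxtrace1 opprB.
by case: n n_odd => // k _; rewrite -natr1 addrK.
Qed.

End Contact.

Definition contract_mx (L : 'M[R]_n) g : seq 'rV[R]_n -> R := fun s =>
  \sum_(i < n) \sum_(j < n | (i < j)%N) L i j * g [:: e_ i, e_ j & s].

(** Converts the sum over i < j used by contraction into the full sum of matrix products: the
    swapped terms fill the lower triangle and the diagonal of L is zero. *)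
Lemma sum_antisymmetric (L : 'M[R]_n) (X : 'I_n -> 'I_n -> R) : L^T = - L ->
  \sum_(i < n) \sum_(j < n | (i < j)%N) L i j * (X i j - X j i) =
  \sum_i \sum_j L i j * X i j.
Proof.
move=> hL.
have Lij i j : L j i = - L i j.
  by have := congr1 (fun X : 'M[R]_n => X i j) hL; rewrite !mxE.
have Lii i : L i i = 0 by have := Lij i i; lra.
transitivity (\sum_(i < n) \sum_(j < n) ((if (i < j)%N then L i j * X i j else
  0) -
    (if (i < j)%N then L i j * X j i else 0))).
  apply: eq_bigr => i _; rewrite big_mkcond; apply: eq_bigr => j _.
  by case: ifP; rewrite ?subr0 // mulrBr.
under eq_bigr do rewrite sumrB.
rewrite sumrB [X in _ - X]exchange_big -sumrB; apply: eq_bigr => i _.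
rewrite -sumrB; apply: eq_bigr => j _; rewrite Lij mulNr.
case: ltngtP => [_|_|/val_inj ->]; rewrite ?opprK ?subr0 ?sub0r ?opprK //.
by rewrite Lii mul0r oppr0.
Qed.

Lemma contract_mxD L g g' s :
  contract_mx L (fun t => g t + g' t) s = contract_mx L g s + contract_mx L g'
    s.
Proof.
rewrite /contract_mx -big_split; apply: eq_bigr => i _ /=.
by rewrite -big_split; apply: eq_bigr => j _; rewrite mulrDr.
Qed.

Lemma contract_mxN L g s : contract_mx L (fun t => - g t) s = - contract_mx L g
  s.
Proof.
rewrite /contract_mx -sumrN; apply: eq_bigr => i _ /=.
by rewrite -sumrN; apply: eq_bigr => j _; rewrite mulrN.
Qed.

(** Evaluate f /\ g on e_i, e_j and [s]. The terms where f takes e_i or e_j add up to a contraction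
    of eta with L, which is zero; in the others f takes a vector of [s]. *)
Lemma contract_mx_wedge1 L (eta : 'rV[R]_n) f g s :
  L^T = - L -> eta *m L = 0 -> (forall i, f (e_ i) = eta 0 i) ->
  contract_mx L (wedge1 f g) s = wedge1 f (contract_mx L g) s.
Proof.
move=> hL etaL fe.
have -> : wedge1 f (contract_mx L g) s = \sum_(i < n) \sum_(j < n | (i < j)%N)
    L i j * wedge1 f (fun t => g [:: e_ i, e_ j & t]) s.
  rewrite wedge1_sumr; apply: eq_bigr => i _.
  by rewrite wedge1_sumr; apply: eq_bigr => j _; rewrite wedge1Zr.
transitivity (\sum_(i < n) \sum_(j < n | (i < j)%N)
    (L i j * (f (e_ i) * g (e_ j :: s) - f (e_ j) * g (e_ i :: s)) +
     L i j * wedge1 f (fun t => g [:: e_ i, e_ j & t]) s)).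
  apply: eq_bigr => i _; apply: eq_bigr => j _.
  by rewrite !wedge1_cons -mulrDr opprB addrCA addrC.
under eq_bigr do rewrite big_split.
rewrite big_split /= sum_antisymmetric // exchange_big big1 ?add0r // => j _.
have := congr1 (fun X : 'rV[R]_n => X 0 j * g (e_ j :: s)) etaL.
rewrite !mxE mul0r => eL; rewrite -[RHS]eL mulr_suml; apply: eq_bigr => i _.
by rewrite fe; ring.
Qed.

(** With w = d eta and f = eta, split w /\ g on e_i, e_j and [s] by how many of e_i, e_j are taken
    by w. Both give r g, with r half of the full double sum; none gives w /\ i(L) g; exactly one
    gives mixed terms, which [W *m L] turns into k g - f /\ i_E g. *)
Lemma contract_mx_wedge2 L (W : 'M[R]_n) (eta E : 'rV[R]_n) f w g s (r : R) :
  L^T = - L -> W^T = - W -> W *m L = eta^T *m E - 1%:M ->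
  \sum_i \sum_j L i j * W i j = r + r ->
  (forall u, f u = \sum_i u 0 i * eta 0 i) ->
  (forall i u, w (e_ i) u = \sum_k W i k * u 0 k) ->
  multilinear g -> antisymmetric g ->
  contract_mx L (wedge2 w g) s =
  r * g s - ((size s)%:R * g s - wedge1 f (ins E g) s) +
  wedge2 w (contract_mx L g) s.
Proof.
move=> hL hW WL sumLW fE wE hm ha.
have Wij i j : W j i = - W i j.
  by have := congr1 (fun X : 'M[R]_n => X i j) hW; rewrite !mxE.
have wee i j : w (e_ i) (e_ j) = W i j.
  rewrite wE (bigD1 j) //= big1 ?addr0 => [|k kj]; rewrite !mxE ?eqxx ?mulr1 //.
  by rewrite (negPf kj) mulr0.
have -> : wedge2 w (contract_mx L g) s = \sum_(i < n) \sum_(j < n | (i < j)%N)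
    L i j * wedge2 w (fun t => g [:: e_ i, e_ j & t]) s.
  rewrite wedge2_sumr; apply: eq_bigr => i _.
  by rewrite wedge2_sumr; apply: eq_bigr => j _; rewrite wedge2Zr.
have step i j : wedge2 w g [:: e_ i, e_ j & s] =
    W i j * g s - (wedge1 (w (e_ i)) (ins (e_ j) g) s -
                   wedge1 (w (e_ j)) (ins (e_ i) g) s) +
    wedge2 w (fun t => g [:: e_ i, e_ j & t]) s.
  by rewrite /= wedge1_cons wee addrA; congr (_ + _); rewrite opprB; ring.
transitivity (\sum_(i < n) \sum_(j < n | (i < j)%N)
    (L i j * W i j * g s +
     (- (L i j * (wedge1 (w (e_ i)) (ins (e_ j) g) s -
                   wedge1 (w (e_ j)) (ins (e_ i) g) s)) +
    L i j * wedge2 w (fun t => g [:: e_ i, e_ j & t]) s))).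
  apply: eq_bigr => i _; apply: eq_bigr => j _.
  by rewrite step; ring.
under eq_bigr do rewrite !big_split.
rewrite !big_split /= addrA; congr (_ + _); congr (_ + _).
  under eq_bigr do rewrite -mulr_suml.
  rewrite -mulr_suml; congr (_ * _).
  have := sum_antisymmetric (fun i j => W i j) hL; rewrite sumLW.
  under eq_bigr => i _ do under eq_bigr => j _ do
    rewrite (Wij i j) opprK mulrDr.
  under eq_bigr do rewrite big_split.
  by rewrite big_split /=; move: (\sum_(i < n) _) => X; lra.
under eq_bigr do rewrite sumrN.
rewrite sumrN; congr (- _).
rewrite (sum_antisymmetric (fun i j => wedge1 (w (e_ i)) (ins (e_ j) g) s)) //.
(* Writing the multiple of g as an alternating sum too puts both sides in the same form, to be
   compared term by term. *)
rewrite -altsum_antisymmetric // -wedge1Nr /wedge1 -altsumD.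
transitivity (altsum (fun u t => \sum_i \sum_j L i j * (w (e_ i) u * g (e_ j ::
  t))) s).
  rewrite altsum_sum; apply: eq_bigr => i _; rewrite altsum_sum.
  by apply: eq_bigr => j _; rewrite altsumZ.
apply: eq_altsum => u t; rewrite /ins mulrN.
(* The j-th component of -(u W L), that is, of u - eta(u) E. *)
have key j : \sum_i L i j * w (e_ i) u = u 0 j - f u * E 0 j.
  under eq_bigr => i _ do rewrite wE mulr_sumr.
  rewrite exchange_big /=.
  transitivity (\sum_k u 0 k * - (W *m L) k j).
    apply: eq_bigr => k _; rewrite mxE -sumrN mulr_sumr; apply: eq_bigr => i _.
    by rewrite (Wij k i); ring.
  rewrite WL; under eq_bigr => k _ do rewrite !mxE big_ord1 !mxE opprB mulrBr.
  rewrite sumrB; congr (_ - _).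
    rewrite (bigD1 j) //= eqxx mulr1 big1 ?addr0 // => k /negPf ->.
    by rewrite mulr0.
  by rewrite fE mulr_suml; apply: eq_bigr => k _; rewrite mulrA.
have gsum v : g (v :: t) = \sum_j v 0 j * g (e_ j :: t).
  rewrite {1}[v]row_sum_delta (multilinear_sum [::] _ _ _ _ hm).
  by apply: eq_bigr => j _; rewrite (multilinearZ [::] _ _ _ hm).
rewrite exchange_big /= gsum (gsum E) mulr_sumr -sumrB; apply: eq_bigr => j _.
rewrite mulrA -mulrBl -key mulr_suml; apply: eq_bigr => i _.
by rewrite mulrA.
Qed.

End ContactLinearAlgebra.

(** * Locality of differentiability, and closure properties of smooth functions *)

Section Smooth.
Context {R : realType} {n : nat}.
Implicit Types (V : set 'rV[R]_n) (f g : 'rV[R]_n -> R^o).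

(** The first-order expansion of f at x is also one of g. Serves to replace a local expression by a
    formula valid only on the image of the chart. *)
Lemma near_eq_differentiable (U W : normedModType R) (f g : U -> W) (x : U) :
  {near x, f =1 g} -> differentiable f x -> differentiable g x.
Proof.
move=> fg df.
have e : g \o shift x = cst (g x) + 'd f x +o_ 0 id.
  apply/eqaddoP => _/posnumP[eps].
  have := diff_locally df => /eqaddoP /(_ eps%:num)/(_ (gt0 eps)).
  apply: filter_app.
  have : \forall y \near (0 : U), f (y + x) = g (y + x).
    by move: (fg); rewrite (near_shift 0) subr0.
  apply: filterS => y exy; rewrite !fctE /= exy.
  by rewrite (nbhs_singleton fg).
have dg : 'd g x = 'd f x :> (U -> W).
  by apply: diff_unique e; apply: diff_continuous.
apply/diff_locallyP; rewrite dg; split=> //.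
exact: diff_continuous.
Qed.

Lemma open_near_eq V (T : Type) (f g : 'rV[R]_n -> T) x : open V ->
  (forall y, V y -> f y = g y) -> V x -> {near x, f =1 g}.
Proof. by move=> oV e Vx; apply: filterS (open_nbhs_nbhs (conj oV Vx)) => y /e.
  Qed.

Lemma class_C_congr k V f g : open V -> (forall x, V x -> f x = g x) ->
  class_C k V f -> class_C k V g.
Proof.
move=> oV; elim: k f g => [|k IH] f g e /=.
  move=> cf x Vx; have fg : {near x, f =1 g} by apply: open_near_eq Vx.
  have := cf x Vx; rewrite /prop_for /continuous_at (e x Vx).
  by apply: cvg_trans; apply: (near_eq_cvg fg).
move=> [df ddf]; split=> [x Vx|v].
  by apply: near_eq_differentiable (df x Vx); apply: (open_near_eq oV).
apply: IH (ddf v) => x Vx; apply: near_eq_derive.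
exact: (open_near_eq oV).
Qed.

Lemma class_C_pred k V f : class_C k.+1 V f -> class_C k V f.
Proof.
elim: k f => [|k IH] f; first by case=> df _ x /df /differentiable_continuous.
by case=> df ddf; split=> // v; apply: IH.
Qed.

Lemma class_C_cst k V (r : R) : class_C k V (cst r : _ -> R^o).
Proof.
elim: k r => [|k IH] r; first by move=> x _; exact: cst_continuous.
split=> [x _|v]; first exact: differentiable_cst.
have -> : (fun x => 'D_v (cst r : 'rV[R]_n -> R^o) x) = cst 0.
  by apply/funext => x; rewrite derive_cst.
exact: IH.
Qed.

Lemma class_CD k V f g : open V -> class_C k V f -> class_C k V g ->
  class_C k V (fun x => f x + g x : R^o).
Proof.
move=> oV; elim: k f g => [|k IH] f g.
  by move=> cf cg x Vx; apply: continuousD; [exact: cf | exact: cg].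
move=> [df ddf] [dg ddg]; split=> [x Vx|v].
  by apply: differentiableD; [apply: df | apply: dg].
apply: (class_C_congr oV) (IH _ _ (ddf v) (ddg v)) => x Vx.
by rewrite deriveD //; apply: diff_derivable; [apply: df | apply: dg].
Qed.

Lemma class_CM k V f g : open V -> class_C k V f -> class_C k V g ->
  class_C k V (fun x => f x * g x : R^o).
Proof.
move=> oV; elim: k f g => [|k IH] f g.
  by move=> cf cg x Vx; apply: continuousM; [exact: cf | exact: cg].
move=> cf cg; have [df ddf] := cf; have [dg ddg] := cg; split=> [x Vx|v].
  by apply: differentiableM; [apply: df | apply: dg].
apply: (class_C_congr oV) (class_CD oV (IH _ _ (class_C_pred cf) (ddg v))
  (IH _ _ (class_C_pred cg) (ddf v))) => x Vx.
by rewrite deriveM //; apply: diff_derivable; [apply: df | apply: dg].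
Qed.

Lemma smooth_on_cst V (r : R) : smooth_on V (fun=> r : R^o).
Proof. by move=> k; apply: class_C_cst. Qed.

Lemma smooth_onD V f g : open V -> smooth_on V f -> smooth_on V g ->
  smooth_on V (fun x => f x + g x : R^o).
Proof. by move=> oV hf hg k; apply: class_CD. Qed.

Lemma smooth_onM V f g : open V -> smooth_on V f -> smooth_on V g ->
  smooth_on V (fun x => f x * g x : R^o).
Proof. by move=> oV hf hg k; apply: class_CM. Qed.

Lemma smooth_on_sum V (I : Type) (r : seq I) (P : pred I)
    (F : I -> 'rV[R]_n -> R^o) : open V -> (forall i, smooth_on V (F i)) ->
  smooth_on V (fun x => \sum_(i <- r | P i) F i x : R^o).
Proof.
move=> oV hF; elim: r => [|i r IH].
  by under eq_fun do rewrite big_nil; apply: smooth_on_cst.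
under eq_fun do rewrite big_cons.
by case: (P i) => //; apply: smooth_onD.
Qed.

Lemma smooth_on_differentiable V (W : normedModType R) (f : 'rV[R]_n -> W) x :
  smooth_on V f -> V x -> differentiable f x.
Proof. by move=> /(_ 1%N)[] /[swap] _; apply. Qed.

End Smooth.

(** * Forms in charts: linear combinations, wedge products, exterior and Lie derivatives *)

Section Forms.
Context {R : realType} {n : nat} {M : topologicalType} {A : manifold R n M}.
Implicit Types (a b : preform A) (c : chart A) (x : 'rV[R]_n).

Lemma cdom_open c : open (cdom c).
Proof. exact: codom_open. Qed.

Lemma form_differentiable k a c x s : Omega k a -> cdom c x ->
  differentiable (fun y => a c y s : R^o) x.
Proof. by move=> ha; apply: smooth_on_differentiable;
  apply: form_smooth ha _ _. Qed.

Lemma form_antisymmetric k a c x : Omega k a -> antisymmetric (a c x).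
Proof.
move=> ha; apply: alternating_antisymmetric.
  exact: form_multilinear ha _ _.
exact: form_alternating ha _ _.
Qed.

Lemma Omega0 k : Omega k (0 : preform A).
Proof.
split=> // [c x s1 s2 r u v|c s]; first by rewrite mulr0 addr0.
exact: smooth_on_cst.
Qed.

(** One operation for both scaling (b = 0) and subtraction (r = -1), so that each operator is shown
    linear once. *)
Definition form_lin r a b : preform A := fun c x s => r * a c x s + b c x s.

Lemma Omega_lin k r a b : Omega k a -> Omega k b ->
  Omega k (form_lin r a b).
Proof.
rewrite /form_lin => ha hb; split=> [c x s cx|c x s sk|c x s1 s2 q u v|c x s1 s2
  s3 u|c s|].
- by rewrite (form_supp ha) // (form_supp hb) // mulr0 addr0.
- by rewrite (form_degree ha) // (form_degree hb) // mulr0 addr0.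
- by rewrite (form_multilinear ha) (form_multilinear hb); ring.
- by rewrite (form_alternating ha) (form_alternating hb) mulr0 addr0.
- apply: smooth_onD (form_smooth hb _ _); first exact: cdom_open.
  apply: smooth_onM (form_smooth ha _ _); first exact: cdom_open.
  exact: smooth_on_cst.
- by move=> c c' x s h; rewrite (form_compat ha s h) (form_compat hb s h).
Qed.

(** Stated for values at a point, as needed for the powers of d eta. *)
Lemma wedge_degree a b c x s (k l : nat) :
  (forall t, size t != k -> a c x t = 0) ->
  (forall t, size t != l -> b c x t = 0) ->
  size s != (k + l)%N -> wedge a b c x s = 0.
Proof.
move=> ha hb sz; rewrite /wedge big1 // => i _;
  rewrite big1 ?mulr0 // => p _ /=.
set t := [seq _ | _ <- _].
have st : size t = size s by rewrite size_map size_enum_ord.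
have lei : (i <= size s)%N by rewrite -ltnS.
have [ik|ik] := eqVneq (i : nat) k; last by rewrite ha ?mul0r ?mulr0 //
  size_takel ?st.
rewrite hb ?mulr0 // size_drop st; apply: contra_neq sz => <-.
by rewrite -ik subnKC.
Qed.

(** Naturality of the wedge product. It is applied with F the derivative of a change of charts, and
    with F a projection of the tangent space. *)
Lemma wedge_map a b c x (F : 'rV[R]_n -> 'rV[R]_n) a' b' c' x' s :
  (forall t, a' c' x' [seq F u | u <- t] = a c x t) ->
  (forall t, b' c' x' [seq F u | u <- t] = b c x t) ->
  wedge a' b' c' x' [seq F u | u <- s] = wedge a b c x s.
Proof.
move=> ha hb; rewrite (wedgeE _ _ _ _ (size_map _ _)).
apply: eq_bigr => i _; congr (_ * _); apply: eq_bigr => p _ /=.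
have -> : [seq nth 0 [seq F u | u <- s] (p k) | k <- enum 'I_(size s)] =
    [seq F u | u <- [seq nth 0 s (p k) | k <- enum 'I_(size s)]].
  by rewrite -[RHS]map_comp; apply: eq_map => k /=; rewrite (nth_map 0).
by rewrite -map_take -map_drop ha hb.
Qed.

Lemma Omega_wedge k l a b : Omega k a -> Omega l b -> Omega (k + l) (wedge a b).
Proof.
move=> ha hb; split=> [c x s cx|c x s sk|c x|c x|c s|c c' x s h].
- rewrite /wedge big1 // => i _; rewrite big1 ?mulr0 // => p _ /=.
  by rewrite (form_supp ha) // mul0r mulr0.
- rewrite /wedge big1 // => i _; rewrite big1 ?mulr0 // => p _ /=.
  set t := [seq _ | _ <- _].
  have st : size t = size s by rewrite size_map size_enum_ord.
  have lei : (i <= size s)%N by rewrite -ltnS.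
  have [ik|ik] := eqVneq (i : nat)%:Z k; last first.
    by rewrite (form_degree ha) ?mul0r ?mulr0 // size_takel ?st.
  rewrite (form_degree hb) ?mulr0 // size_drop st; apply: contra_neq sk => <-.
  by rewrite -ik -PoszD subnKC.
- by apply: wedge_multilinear; [exact: form_multilinear ha _ _ | exact:
  form_multilinear hb _ _].
- exact: wedge_alternating.
- rewrite /wedge; have oc := cdom_open (c := c).
  apply: smooth_on_sum => // i; apply: smooth_onM => //.
    exact: smooth_on_cst.
  apply: smooth_on_sum => // p; apply: smooth_onM => //.
    exact: smooth_on_cst.
  by apply: smooth_onM => //; [exact: form_smooth ha _ _ | exact: form_smooth hb
    _ _].
- apply/esym/wedge_map => t.
    by rewrite -(form_compat ha t h).
  by rewrite -(form_compat hb t h).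
Qed.

Lemma extdE a c x s : cdom c x ->
  extd a c x s = altsum (fun v t => 'D_v (fun y => a c y t : R^o) x) s.
Proof. by move=> cx; rewrite /extd mem_set // (altsumE 0). Qed.

Lemma extd_supp a c x s : ~ cdom c x -> extd a c x s = 0.
Proof. by move=> cx; rewrite /extd memNset. Qed.

Lemma altsum_multilinear (G : 'rV[R]_n -> seq 'rV[R]_n -> R) :
  (forall r u v t, G (r *: u + v) t = r * G u t + G v t) ->
  (forall u, multilinear (G u)) -> multilinear (altsum G).
Proof.
move=> h1 h2 s1; elim: s1 G h1 h2 => [|w s1 IH] G h1 h2 s2 r u v /=.
  have -> : altsum (fun z t => G z ((r *: u + v) :: t)) s2 =
      r * altsum (fun z t => G z (u :: t)) s2 +
      altsum (fun z t => G z (v :: t)) s2.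
    rewrite -altsumZ -altsumD; apply: eq_altsum => z t.
    exact: (h2 z [::]).
  by rewrite h1; ring.
rewrite h2 (IH (fun u t => G u (w :: t))) //; first by ring.
by move=> z t1 t2 q y1 y2; apply: (h2 z (w :: t1)).
Qed.

Lemma derive_lin (f : 'rV[R]_n -> R^o) x r u v : differentiable f x ->
  'D_(r *: u + v) f x = r * 'D_u f x + 'D_v f x.
Proof. by move=> df; rewrite !deriveE // linearP. Qed.

Lemma derive_multilinear (f : 'rV[R]_n -> seq 'rV[R]_n -> R^o) x u :
  (forall y, multilinear (f y)) -> (forall t, differentiable (f^~ t) x) ->
  multilinear (fun t => 'D_u (f^~ t) x).
Proof.
move=> hm hd s1 s2 r v w /=.
have -> : f^~ (s1 ++ (r *: v + w) :: s2) =
    r *: f^~ (s1 ++ v :: s2) + f^~ (s1 ++ w :: s2).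
  by apply/funext => y; rewrite hm.
have dv t : derivable (f^~ t) x u by apply: diff_derivable.
have dv1 := dv (s1 ++ v :: s2); have dv2 := dv (s1 ++ w :: s2).
by rewrite (deriveD (derivableZ (k := r) dv1) dv2) (deriveZ r dv1).
Qed.

Lemma extd_multilinear k a c x : Omega k a -> multilinear (extd a c x).
Proof.
move=> ha s1 s2 r u v; have [cx|cx] := EM (cdom c x); last first.
  by rewrite !extd_supp // mulr0 addr0.
rewrite !extdE //; apply: altsum_multilinear => {s1 s2 r u v} => [r u v t|u].
  by apply: derive_lin; apply: form_differentiable ha cx.
apply: derive_multilinear => [y|t]; first exact: form_multilinear ha _ _.
exact: form_differentiable ha cx.
Qed.

Lemma extd_degree a c x s k :
  (forall y t, size t != k -> a c y t = 0) -> size s != k.+1 ->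
  extd a c x s = 0.
Proof.
move=> ha sz; rewrite /extd; case: ifP => // _; rewrite big1 // => i _.
set t := _ ++ _.
have -> : (fun y => a c y t : R^o) = cst 0.
  apply/funext => y; rewrite ha // size_cat size_drop size_takel ?(ltnW (ltn_ord
    i)) //.
  by apply: contra_neq sz; have := ltn_ord i; lia.
by rewrite derive_cst mulr0.
Qed.

Lemma extd_form1 a c x u v : cdom c x -> extd a c x [:: u; v] =
  'D_u (fun y => a c y [:: v] : R^o) x - 'D_v (fun y => a c y [:: u] : R^o) x.
Proof. by move=> cx; rewrite extdE //= subr0. Qed.

Lemma contract_lin (K : bivector A) r a b :
  contract K (form_lin r a b) = form_lin r (contract K a) (contract K b).
Proof.
apply/funext => c; apply/funext => x; apply/funext => s.
rewrite /contract /form_lin mulr_sumr -big_split /=; apply: eq_bigr => i _.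
by rewrite mulr_sumr -big_split /=; apply: eq_bigr => j _; ring.
Qed.

Lemma derive_form_lin r a b c x s v :
  differentiable (fun y => a c y s : R^o) x ->
  differentiable (fun y => b c y s : R^o) x ->
  'D_v (fun y => form_lin r a b c y s : R^o) x =
  r * 'D_v (fun y => a c y s : R^o) x + 'D_v (fun y => b c y s : R^o) x.
Proof.
move=> /(diff_derivable (v := v)) da /(diff_derivable (v := v)) db.
by rewrite (deriveD (derivableZ (k := r) da) db) (deriveZ r da).
Qed.

Lemma extd_lin r a b c x s :
  (cdom c x -> forall t, differentiable (fun y => a c y t : R^o) x) ->
  (cdom c x -> forall t, differentiable (fun y => b c y t : R^o) x) ->
  extd (form_lin r a b) c x s = r * extd a c x s + extd b c x s.
Proof.
move=> da db; have [cx|cx] := EM (cdom c x); last first.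
  by rewrite !extd_supp // mulr0 addr0.
rewrite !extdE // -altsumZ -altsumD; apply: eq_altsum => v t.
by apply: derive_form_lin; [exact: da | exact: db].
Qed.

Lemma lieE (X : vfield A) a c x s : cdom c x -> lie X a c x s =
  'D_(X c x) (fun y => a c y s : R^o) x +
  derivation (fun v => 'D_v (X c) x) (a c x) s.
Proof. by move=> cx; rewrite /lie mem_set // (derivationE 0). Qed.

Lemma lie_supp (X : vfield A) a c x s : ~ cdom c x -> lie X a c x s = 0.
Proof. by move=> cx; rewrite /lie memNset. Qed.

Lemma lie_lin (X : vfield A) r a b c x s :
  (cdom c x -> forall t, differentiable (fun y => a c y t : R^o) x) ->
  (cdom c x -> forall t, differentiable (fun y => b c y t : R^o) x) ->
  lie X (form_lin r a b) c x s = r * lie X a c x s + lie X b c x s.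
Proof.
move=> da db; have [cx|cx] := EM (cdom c x); last first.
  by rewrite !lie_supp // mulr0 addr0.
rewrite !lieE // derive_form_lin; [|exact: da|exact: db].
by rewrite derivationD derivationZ; ring.
Qed.

End Forms.

(** * The contact condition makes flat invertible *)

Section ContactForm.
Context {R : realType} {n : nat} {M : topologicalType} {A : manifold R n M}.
Variables (eta : preform A) (c : chart A) (x : 'rV[R]_n).
Hypotheses (heta : Omega 1 eta) (cx : cdom c x).

Definition form_row : 'rV[R]_n := \row_j eta c x [:: e_ j].
Definition extd_mx : 'M[R]_n := \matrix_(i, j) extd eta c x [:: e_ i; e_ j].

Lemma form_rowE u : eta c x [:: u] = \sum_i u 0 i * form_row 0 i.
Proof.
have hm := form_multilinear heta c x.
rewrite [u in LHS]row_sum_delta (multilinear_sum [::] _ _ _ _ hm).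
by apply: eq_bigr => i _; rewrite (multilinearZ [::] _ _ _ hm) mxE.
Qed.

Lemma form_row_mul u : u *m form_row^T = (eta c x [:: u])%:M.
Proof.
apply/rowP => i; rewrite ord1 form_rowE !mxE eqxx mulr1n.
by apply: eq_bigr => j _; rewrite !mxE.
Qed.

Lemma extd_antisym u v : extd eta c x [:: u; v] = - extd eta c x [:: v; u].
Proof. by rewrite !extd_form1 // opprB. Qed.

Lemma extd_mxE i u : extd eta c x [:: e_ i; u] = \sum_k extd_mx i k * u 0 k.
Proof.
have hm := extd_multilinear c x heta.
rewrite [u in LHS]row_sum_delta (multilinear_sum [:: _] _ _ _ _ hm).
by apply: eq_bigr => k _; rewrite (multilinearZ [:: _] _ _ _ hm) mxE mulrC.
Qed.

Lemma extd_mx_mul u v :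
  extd eta c x [:: u; v] = (u *m extd_mx *m v^T) 0 0.
Proof.
have hm := extd_multilinear c x heta.
rewrite [u in LHS]row_sum_delta (multilinear_sum [::] _ _ _ _ hm).
rewrite -mulmxA mxE; apply: eq_bigr => i _.
rewrite (multilinearZ [::] _ _ _ hm) extd_mxE mxE; congr (_ * _).
by apply: eq_bigr => k _; rewrite [v^T _ _]mxE.
Qed.

Lemma extd_mx_tr : extd_mx^T = - extd_mx.
Proof. by apply/matrixP => i j; rewrite !mxE extd_antisym. Qed.

Lemma lin1_mx_flat :
  lin1_mx (flat eta c x) = extd_mx + form_row^T *m form_row.
Proof. by apply/matrixP => i j; rewrite !mxE big_ord1 !mxE. Qed.

(* A vector v <> 0 with flat v = 0 satisfies eta(v) = 0 and i_v (d eta) = 0, so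
   eta /\ (d eta)^m factors through a projection along v, whose image has
   dimension less than n. *)
Lemma contact_flat_unit m : n = (2 * m).+1 ->
  (exists s, wedge eta (wedge_pow (extd eta) m) c x s != 0) ->
  lin1_mx (flat eta c x) \in unitmx.
Proof.
move=> nm [s]; rewrite unitmxE unitfE; apply: contra_neq => /eqP/det0P[v v0].
rewrite lin1_mx_flat => vF.
have flatv u : extd eta c x [:: v; u] + eta c x [:: v] * eta c x [:: u] = 0.
  transitivity ((v *m (extd_mx + form_row^T *m form_row) *m u^T) 0 0).
    rewrite mulmxDr mulmxDl mxE -extd_mx_mul; congr (_ + _).
    rewrite mulmxA form_row_mul mul_scalar_mx -scalemxAl mxE; congr (_ * _).
    by rewrite -[_ *m _]trmxK trmx_mul trmxK form_row_mul tr_scalar_mx mxE.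
  by rewrite vF mul0mx mxE.
(* At u = v the term d eta(v, v) vanishes and eta(v)^2 = 0 remains. *)
have etav : eta c x [:: v] = 0.
  have := flatv v; rewrite extd_form1 // subrr add0r => /eqP.
  by rewrite mulf_eq0 orbb => /eqP.
have extv u : extd eta c x [:: v; u] = 0.
  by have := flatv u; rewrite etav mul0r addr0.
have [i vi] : exists i, v 0 i != 0.
  apply/existsP; apply: contra_neqT v0; rewrite negb_exists => /forallP h.
  by apply/rowP => i; rewrite mxE; apply/eqP; have := h i; rewrite negbK.
(* The projection u |-> u - (u_i / v_i) v. It kills v, hence has determinant 0, and it changes its
   argument only by multiples of v, which eta and d eta do not see. *)
pose P : 'M[R]_n := 1%:M - (v 0 i)^-1 *: (delta_mx i 0 *m v).
have PE u : u *m P = (- ((v 0 i)^-1 * u 0 i)) *: v + u.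
  rewrite mulmxBr mulmx1 -scalemxAr mulmxA addrC scaleNr -scalerA;
    congr (- (_ *: _) + _).
  by rewrite -colE [col _ _]mx11_scalar mxE mul_scalar_mx.
have vP : v *m P = 0 by rewrite PE mulVf // scaleN1r addNr.
have hme := form_multilinear heta c x; have hmd := extd_multilinear c x heta.
have etaP t : eta c x [seq u *m P | u <- t] = eta c x t.
  have [st|st] := eqVneq (size t) 1%N; last first.
    by rewrite !(form_degree heta) // size_map.
  by case: t st => [|u []] //= _; rewrite PE (hme [::]) etav mulr0 add0r.
have extP t : extd eta c x [seq u *m P | u <- t] = extd eta c x t.
  have [st|st] := eqVneq (size t) 2%N; last first.
    by rewrite !(@extd_degree _ _ _ _ _ _ _ _ 1) ?size_map // => y t' st';
      apply: (form_degree heta).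
  case: t st => [|u [|w []]] //= _; rewrite !PE (hmd [::]) /= extv mulr0 add0r.
  by rewrite (hmd [:: u]) /= extd_antisym extv oppr0 mulr0 add0r.
have powP t : wedge_pow (extd eta) m c x [seq u *m P | u <- t] =
    wedge_pow (extd eta) m c x t.
  elim: m {nm s} t => [|m IH] t; first by rewrite /= /form1 !/nilp size_map.
  exact: wedge_map.
have pow_multi : multilinear (wedge_pow (extd eta) m c x).
  elim: m {nm s powP} => [|m IH]; last exact: wedge_multilinear.
  move=> s1 s2 r u w; rewrite /= /form1 /nilp !size_cat /= !addnS !andbF.
  by rewrite mulr0 addr0.
have pow_deg t : size t != (2 * m)%N -> wedge_pow (extd eta) m c x t = 0.
  elim: m {nm s powP pow_multi} t => [|m IH] t st.
    by move: st; rewrite muln0 /= /form1 /nilp => /negPf ->; rewrite andbF.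
  apply: (@wedge_degree _ _ _ _ _ _ _ _ _ 2 (2 * m)) => // [t' st'|].
    by apply: (@extd_degree _ _ _ _ _ _ _ _ 1) => // y t'' ?;
      apply: (form_degree heta).
  by apply: contra_neq st => ->; lia.
have eta_deg t : size t != 1%N -> eta c x t = 0.
  by move=> st; apply: (form_degree heta).
have [st|st] := eqVneq (size s) n; last first.
  apply: wedge_degree eta_deg pow_deg _.
  by apply: contra_neq st => ->; rewrite nm; lia.
rewrite -(wedge_map s etaP powP); apply: alternating_singular.
- exact: wedge_multilinear.
- exact: wedge_alternating.
- have -> : \matrix_(j < n) nth 0 [seq u *m P | u <- s] j =
      (\matrix_(j < n) nth 0 s j) *m P.
    by apply/row_matrixP => j; rewrite row_mul !rowK (nth_map 0) // st.
  rewrite det_mulmx; have /eqP -> : \det P == 0 by apply/det0P; exists v.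
  by rewrite mulr0.
- by rewrite size_map.
Qed.

End ContactForm.

(** * Leibniz rules for the product with a 1-form *)

Section Leibniz.
Context {R : realType} {n : nat}.
Implicit Types (f : 'rV[R]_n -> 'rV[R]_n -> R^o).
Implicit Types (a : 'rV[R]_n -> seq 'rV[R]_n -> R^o).

Lemma is_derive_wedge1 f a x v t :
  (forall u, derivable (f^~ u) x v) -> (forall s, derivable (a^~ s) x v) ->
  is_derive x v (fun y => wedge1 (f y) (a y) t : R^o)
    (wedge1 (fun u => 'D_v (f^~ u) x) (a x) t +
     wedge1 (f x) (fun s => 'D_v (a^~ s) x) t).
Proof.
move=> df; elim: t a => [|u t IH] a da.
  by rewrite addr0; apply: is_derive_cst.
have df' := derivableP (df u); have da' := derivableP (da t).
have H := is_deriveB (is_deriveM df' da')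
  (IH (fun y => ins u (a y)) (fun s => da (u :: s))).
apply: is_derive_eq H _.
rewrite !wedge1_cons /ins /=.
by rewrite -[_ *: 'D_v (f^~ u) x]/(_ * _) -[_ *: 'D_v (a^~ t) x]/(_ * _); ring.
Qed.

(** The rule d(f /\ a) = df /\ a - f /\ da in a chart. It asks only for derivable coefficients, so
    it applies to i(Lambda) a as well as to a form a. *)
Lemma altsum_derive_wedge1 f a x s :
  (forall u v, derivable (f^~ u) x v) ->
  (forall t v, derivable (a^~ t) x v) ->
  altsum (fun v t => 'D_v (fun y => wedge1 (f y) (a y) t : R^o) x) s =
  wedge2 (fun u v => 'D_u (f^~ v) x - 'D_v (f^~ u) x) (a x) s -
  wedge1 (f x) (altsum (fun v t => 'D_v (a^~ t) x)) s.
Proof.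
move=> df; elim: s a => [|v s IH] a da; first by rewrite /wedge1 /= subr0.
have dw u t a' : (forall t v, derivable (a'^~ t) x v) ->
    'D_u (fun y => wedge1 (f y) (a' y) t : R^o) x =
    wedge1 (fun z => 'D_u (f^~ z) x) (a' x) t +
    wedge1 (f x) (fun s => 'D_u (a'^~ s) x) t.
  by move=> da'; have H := is_derive_wedge1 t (df^~ u) (da'^~ u);
    apply: derive_val.
have dav t u : derivable (fun y => ins v (a y) t) x u by apply: da.
rewrite [LHS]/=.
have -> : altsum (fun u t => 'D_u (fun y => wedge1 (f y) (a y) (v :: t) : R^o)
  x) s =
    wedge1 (fun u => 'D_u (f^~ v) x) (a x) s +
    f x v * altsum (fun u t => 'D_u (a^~ t) x) s -
    altsum (fun u t => 'D_u (fun y => wedge1 (f y) (ins v (a y)) t : R^o) x) s.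
  rewrite -altsumZ -mulN1r -altsumZ -!altsumD; apply: eq_altsum => u t.
  rewrite dw // dw // !wedge1_cons /ins; ring.
rewrite (IH (fun y => ins v (a y))) // dw // [in RHS]/= wedge1_cons.
have -> : wedge1 (f x) (ins v (altsum (fun u t => 'D_u (a^~ t) x))) s =
    wedge1 (f x) (fun t => 'D_v (a^~ t) x) s -
    wedge1 (f x) (altsum (fun u t => 'D_u (fun y => ins v (a y) t) x)) s.
  by rewrite -wedge1Nr -wedge1Dr.
have -> : wedge1 (fun u => 'D_v (f^~ u) x - 'D_u (f^~ v) x) (a x) s =
    wedge1 (fun u => 'D_v (f^~ u) x) (a x) s -
    wedge1 (fun u => 'D_u (f^~ v) x) (a x) s.
  by rewrite -wedge1Nl -wedge1Dl.
ring.
Qed.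

End Leibniz.

(** * Differentiability of matrix products, determinants and inverses *)

Section DifferentiableMatrices.
Context {R : realType} {V : normedModType R}.
Implicit Types (x : V).

Lemma differentiable_bigsum (I : Type) (r : seq I) (P : pred I)
    (F : I -> V -> R^o) x : (forall i, differentiable (F i) x) ->
  differentiable (fun y => \sum_(i <- r | P i) F i y : R^o) x.
Proof.
move=> dF; elim: r => [|i r IH].
  under eq_fun do rewrite big_nil; exact: differentiable_cst.
under eq_fun do rewrite big_cons.
by case: (P i) => //; apply: differentiableD.
Qed.

Lemma differentiable_bigprod (I : Type) (r : seq I) (P : pred I)
    (F : I -> V -> R^o) x : (forall i, differentiable (F i) x) ->
  differentiable (fun y => \prod_(i <- r | P i) F i y : R^o) x.
Proof.
move=> dF; elim: r => [|i r IH].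
  under eq_fun do rewrite big_nil; exact: differentiable_cst.
under eq_fun do rewrite big_cons.
by case: (P i) => //; apply: differentiableM.
Qed.

Lemma differentiable_mulmx k l p (F : V -> 'M[R]_(k, l)) (G : V -> 'M[R]_(l, p))
    x : (forall i j, differentiable (fun y => F y i j : R^o) x) ->
  (forall i j, differentiable (fun y => G y i j : R^o) x) ->
  forall i j, differentiable (fun y => (F y *m G y) i j : R^o) x.
Proof.
move=> dF dG i j; under eq_fun do rewrite mxE.
by apply: differentiable_bigsum => q; apply: differentiableM.
Qed.

Lemma differentiable_det k (F : V -> 'M[R]_k) x :
  (forall i j, differentiable (fun y => F y i j : R^o) x) ->
  differentiable (fun y => \det (F y) : R^o) x.
Proof.
move=> dF; rewrite /determinant; apply: differentiable_bigsum => p.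
apply: differentiableM; first exact: differentiable_cst.
by apply: differentiable_bigprod.
Qed.

(** Near x the inverse is given by cofactors over the determinant. Invertibility is assumed on a
    neighbourhood because [invmx] returns a singular matrix unchanged. *)
Lemma differentiable_invmx k (F : V -> 'M[R]_k) x :
  (forall i j, differentiable (fun y => F y i j : R^o) x) ->
  (\forall y \near x, F y \in unitmx) ->
  forall i j, differentiable (fun y => invmx (F y) i j : R^o) x.
Proof.
move=> dF uF i j.
apply: (@near_eq_differentiable _ _ _
  (fun y => (\det (F y))^-1 * ((-1) ^+ (j + i) * \det (row' j (col' i (F
    y)))))).
  by apply: filterS uF => y uy; rewrite /invmx uy !mxE.
apply: differentiableM.
  apply: (@differentiableV _ _ (fun y => \det (F y))).
    exact: differentiable_det.
  by rewrite -unitfE -unitmxE; apply: (nbhs_singleton uF).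
apply: differentiableM; first exact: differentiable_cst.
apply: differentiable_det => i' j'; under eq_fun do rewrite !mxE.
exact: dF.
Qed.

End DifferentiableMatrices.

(** * The Reeb field E and the bivector Lambda in a chart *)

Section ContactCalculus.
Context {R : realType} {m : nat} {M : topologicalType}.
Context {A : manifold R (2 * m).+1 M} {eta : preform A}.
Hypothesis heta : contact_form m eta.
Variable c : chart A.
Local Notation E := (contact_vfield eta).
Local Notation L := (contact_bivector eta).
Local Notation etaf x := (fun v => eta c x [:: v]).
Local Notation deta x := (fun u v => extd eta c x [:: u; v]).

Definition contact_mx x := jacobi_mx (extd_mx eta c x) (form_row eta c x).

Let eta1 : Omega 1 eta. Proof. by case: heta. Qed.

Let dim_odd : odd (2 * m).+1. Proof. by rewrite /= oddM. Qed.

Lemma contact_mx_unit x : cdom c x ->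
  extd_mx eta c x + (form_row eta c x)^T *m form_row eta c x \in unitmx.
Proof.
move=> cx; rewrite -lin1_mx_flat //.
by apply: (contact_flat_unit eta1 cx (erefl _)); apply: heta.2.
Qed.

Lemma contact_vfieldE x :
  E c x = reeb_row (extd_mx eta c x) (form_row eta c x).
Proof. by rewrite /contact_vfield /sharp lin1_mx_flat. Qed.

Lemma contact_bivectorE x i j : cdom c x ->
  L c x (e_ i) (e_ j) = contact_mx x i j.
Proof.
move=> cx; rewrite /contact_bivector /sharp lin1_mx_flat extd_mx_mul //.
rewrite /contact_mx /jacobi_mx /e_ -!rowE -row_mul [LHS]mxE [RHS]mxE.
by apply: eq_bigr => k _; rewrite !mxE.
Qed.

Lemma contract_contactE a x s : cdom c x ->
  contract L a c x s = contract_mx (contact_mx x) (a c x) s.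
Proof.
move=> cx; apply: eq_bigr => i _; apply: eq_bigr => j _.
by rewrite contact_bivectorE.
Qed.

Lemma contact_eta_reeb x : cdom c x -> eta c x [:: E c x] = 1.
Proof.
move=> cx; have [_] := reeb_rowP dim_odd (extd_mx_tr eta cx) (contact_mx_unit
  cx).
rewrite -contact_vfieldE form_row_mul // => /(congr1 (fun X : 'M[R]_1 => X 0
  0)).
by rewrite !mxE.
Qed.

Lemma contact_deta_reeb x u : cdom c x -> extd eta c x [:: E c x; u] = 0.
Proof.
move=> cx; have [EW _] := reeb_rowP dim_odd (extd_mx_tr eta cx) (contact_mx_unit
  cx).
by rewrite extd_mx_mul // contact_vfieldE EW mul0mx mxE.
Qed.

Lemma differentiable_form_row x i : cdom c x ->
  differentiable (fun y => form_row eta c y 0 i : R^o) x.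
Proof.
move=> cx; under eq_fun do rewrite mxE; exact: form_differentiable eta1 cx.
Qed.

Lemma differentiable_extd_mx x i j : cdom c x ->
  differentiable (fun y => extd_mx eta c y i j : R^o) x.
Proof.
move=> cx.
apply: (@near_eq_differentiable _ _ _ (fun y =>
  'D_(e_ i) (fun z => eta c z [:: e_ j] : R^o) y -
  'D_(e_ j) (fun z => eta c z [:: e_ i] : R^o) y)).
  by apply: open_near_eq (@cdom_open _ _ _ _ c) _ cx => y cy;
    rewrite mxE extd_form1.
have dd u v : differentiable ('D_u (fun z => eta c z [:: v] : R^o)) x.
  by have [_ /(_ u)[/(_ x cx)]] := form_smooth eta1 c [:: v] 2%N.
exact: (differentiableB (dd (e_ i) (e_ j)) (dd (e_ j) (e_ i))).
Qed.

Lemma differentiable_flat_mx x i j : cdom c x -> differentiable (fun y =>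
  (extd_mx eta c y + (form_row eta c y)^T *m form_row eta c y) i j : R^o) x.
Proof.
move=> cx; under eq_fun do rewrite mxE.
apply: differentiableD; first exact: differentiable_extd_mx.
apply: differentiable_mulmx => i' j'; last first.
  by rewrite (ord1 i'); apply: differentiable_form_row.
by rewrite (ord1 j'); under eq_fun do rewrite mxE;
  apply: differentiable_form_row.
Qed.

Lemma differentiable_inv_flat_mx x i j : cdom c x -> differentiable (fun y =>
  invmx (extd_mx eta c y + (form_row eta c y)^T *m form_row eta c y) i j : R^o)
    x.
Proof.
move=> cx; apply: differentiable_invmx => [i' j'|].
  exact: differentiable_flat_mx.
apply: filterS (open_nbhs_nbhs (conj (@cdom_open _ _ _ _ c) cx)) => y.
exact: contact_mx_unit.
Qed.

Lemma differentiable_contact_mx x i j : cdom c x ->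
  differentiable (fun y => contact_mx y i j : R^o) x.
Proof.
move=> cx; apply: differentiable_mulmx => i' j'; last first.
  by under eq_fun do rewrite mxE; apply: differentiable_inv_flat_mx.
apply: differentiable_mulmx => i1 j1; first exact: differentiable_inv_flat_mx.
exact: differentiable_extd_mx.
Qed.

Lemma differentiable_reeb x i : cdom c x ->
  differentiable (fun y => E c y 0 i : R^o) x.
Proof.
move=> cx; under eq_fun do rewrite contact_vfieldE.
apply: differentiable_mulmx => i' j'; last exact: differentiable_inv_flat_mx.
by rewrite (ord1 i'); apply: differentiable_form_row.
Qed.

(** Supplies the differentiability of i(Lambda) a that d i(Lambda) requires: within the chart,
    Lambda is a matrix expression in the components of eta and d eta. *)
Lemma differentiable_contract k a x s : Omega k a -> cdom c x ->
  differentiable (fun y => contract L a c y s : R^o) x.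
Proof.
move=> ha cx.
apply: (@near_eq_differentiable _ _ _
  (fun y => contract_mx (contact_mx y) (a c y) s)).
  by apply: open_near_eq (@cdom_open _ _ _ _ c) _ cx => y cy;
    rewrite contract_contactE.
apply: differentiable_bigsum => i; apply: differentiable_bigsum => j.
apply: differentiableM; first exact: differentiable_contact_mx.
exact: form_differentiable ha cx.
Qed.

Lemma wedge_contactE k a x s : Omega k a ->
  wedge eta a c x s = wedge1 (etaf x) (a c x) s.
Proof.
move=> ha; apply: wedge_wedge1; last exact: form_antisymmetric ha.
by move=> t st; apply: (form_degree eta1).
Qed.

(* As d eta (E, u) = 0 and eta (E) is constant, L_E eta = 0. *)
Lemma lie_contact x u : cdom c x ->
  'D_(E c x) (fun y => eta c y [:: u] : R^o) x +
  eta c x [:: 'D_u (E c) x] = 0.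
Proof.
move=> cx.
have dE : derivable (E c) x u.
  apply/derivable_mxP => i j; rewrite (ord1 i).
  exact/diff_derivable/differentiable_reeb.
(* The constant function eta(E) = 1 is written in components, so that the product rule separates the
   derivatives of E and of eta. *)
have : 'D_u (fun y => \sum_i E c y 0 i * form_row eta c y 0 i : R^o) x = 0.
  transitivity ('D_u (cst (1 : R^o) : _ -> R^o) x); last exact: derive_cst.
  apply: near_eq_derive.
  apply: open_near_eq (@cdom_open _ _ _ _ c) _ cx => y cy.
  transitivity (eta c y [:: E c y]); last exact: contact_eta_reeb.
  by rewrite (form_rowE _ _ eta1).
have -> : (fun y => \sum_i E c y 0 i * form_row eta c y 0 i : R^o) =
    \sum_(i < _) ((fun y => E c y 0 i : R^o) * (fun y => form_row eta c y 0 i :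
      R^o)).
  by apply/funext => y; rewrite fct_sumE.
have dEi i : derivable (fun y => E c y 0 i : R^o) x u.
  exact/diff_derivable/differentiable_reeb.
have dri i : derivable (fun y => form_row eta c y 0 i : R^o) x u.
  exact/diff_derivable/differentiable_form_row.
rewrite derive_sum => [|i]; last exact: derivableM.
under eq_bigr => i _ do rewrite deriveM //.
rewrite big_split /=.
(* Since d eta(E, u) = 0, the derivative of eta(u) along E equals the derivative along u of eta(E
   x), with E frozen at x. *)
have -> : \sum_i E c x 0 i *: 'D_u (fun y => form_row eta c y 0 i : R^o) x =
    'D_(E c x) (fun y => eta c y [:: u] : R^o) x.
  have := contact_deta_reeb u cx; rewrite extd_form1 // => /subr0_eq ->.
  have -> : (fun y => eta c y [:: E c x] : R^o) = \sum_(i < _)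
      (E c x 0 i *: (fun y => form_row eta c y 0 i : R^o)).
    by apply/funext => y; rewrite fct_sumE (form_rowE _ _ eta1).
  rewrite derive_sum => [|i]; last exact: derivableZ.
  by apply: eq_bigr => i _; rewrite deriveZ.
move=> <-; congr (_ + _); rewrite (form_rowE _ _ eta1); apply: eq_bigr => i _.
by rewrite derive_mx // mxE mulrC.
Qed.

End ContactCalculus.

Arguments contact_mx {R m M A} eta c x.

(** * Commutation of eta /\ _ with each term of the differential *)

Section Homotopy.
Context {R : realType} {m : nat} {M : topologicalType}.
Context {A : manifold R (2 * m).+1 M} {eta : preform A}.
Hypothesis heta : contact_form m eta.
Local Notation E := (contact_vfield eta).
Local Notation L := (contact_bivector eta).

Let eta1 : Omega 1 eta. Proof. by case: heta. Qed.

Let dim_odd : odd (2 * m).+1. Proof. by rewrite /= oddM. Qed.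

Section AtPoint.
Variables (k : int) (a : preform A) (c : chart A) (x : 'rV[R]_(2 * m).+1).
Hypotheses (ha : Omega k a) (cx : cdom c x).
Local Notation etax := (fun v => eta c x [:: v]).
Local Notation detax := (fun u v => extd eta c x [:: u; v]).

(** Stated at every point y of the chart because [extd_contract_wedge] differentiates this equality
    at x. *)
Lemma contract_wedge y s : cdom c y ->
  contract L (wedge eta a) c y s =
  wedge1 (fun v => eta c y [:: v]) (contract L a c y) s.
Proof.
move=> cy.
have cu := contact_mx_unit heta cy; have ct := extd_mx_tr eta cy.
have -> : contract L a c y = contract_mx (contact_mx eta c y) (a c y).
  by apply/funext => t; rewrite contract_contactE.
rewrite contract_contactE // -(contract_mx_wedge1 (eta := form_row eta c y)) //.
- apply: eq_bigr => i _; apply: eq_bigr => j _.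
  by rewrite (wedge_contactE heta _ _ _ ha).
- exact: jacobi_mx_tr.
- exact: mul_eta_jacobi.
- by move=> i; rewrite mxE.
Qed.

Lemma extd_wedge s :
  extd (wedge eta a) c x s =
  wedge2 detax (a c x) s - wedge1 etax (extd a c x) s.
Proof.
have -> : extd a c x = altsum (fun v t => 'D_v (fun y => a c y t : R^o) x).
  by apply/funext => t; rewrite extdE.
have -> : wedge2 detax (a c x) s =
    wedge2 (fun u v => 'D_u (fun y => eta c y [:: v] : R^o) x -
                       'D_v (fun y => eta c y [:: u] : R^o) x) (a c x) s.
  by apply: eq_wedge2 => // u v; rewrite extd_form1.
rewrite -(altsum_derive_wedge1 s (f := fun y v => eta c y [:: v]) (a := a c)).
- rewrite extdE //; apply: eq_altsum => v t; congr ('D_v _ x).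
  by apply/funext => y; rewrite (wedge_contactE heta _ _ _ ha).
- by move=> u v; apply/diff_derivable/(form_differentiable _ eta1 cx).
- by move=> t v; apply/diff_derivable/(form_differentiable _ ha cx).
Qed.

Lemma extd_contract_wedge s :
  extd (contract L (wedge eta a)) c x s =
  wedge2 detax (contract L a c x) s - wedge1 etax (extd (contract L a) c x) s.
Proof.
have -> : extd (contract L a) c x =
    altsum (fun v t => 'D_v (fun y => contract L a c y t : R^o) x).
  by apply/funext => t; rewrite extdE.
have -> : wedge2 detax (contract L a c x) s =
    wedge2 (fun u v => 'D_u (fun y => eta c y [:: v] : R^o) x -
                       'D_v (fun y => eta c y [:: u] : R^o) x)
      (contract L a c x) s.
  by apply: eq_wedge2 => // u v; rewrite extd_form1.
rewrite -(altsum_derive_wedge1 s (f := fun y v => eta c y [:: v])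
  (a := contract L a c)).
- rewrite extdE //; apply: eq_altsum => v t; apply: near_eq_derive.
  by apply: open_near_eq (@cdom_open _ _ _ _ c) _ cx => y cy;
    apply: contract_wedge.
- by move=> u v; apply/diff_derivable/(form_differentiable _ eta1 cx).
- by move=> t v; apply/diff_derivable/(differentiable_contract heta _ ha cx).
Qed.

Lemma contract_extd_wedge s :
  contract L (extd (wedge eta a)) c x s =
  m%:R * a c x s - (k%:~R * a c x s - wedge1 etax (interior E a c x) s) +
  wedge2 detax (contract L a c x) s - wedge1 etax (contract L (extd a) c x) s.
Proof.
have cu := contact_mx_unit heta cx; have ct := extd_mx_tr eta cx.
(* The integer degree and the number of arguments can differ only where [a] vanishes. *)
have ks : k%:~R * a c x s = (size s)%:R * a c x s.
  have [<-//|sk] := eqVneq (size s)%:Z k.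
  by rewrite (form_degree ha) // !mulr0.
have eC b : contract L b c x = contract_mx (contact_mx eta c x) (b c x).
  by apply/funext => t; rewrite contract_contactE.
have eEa : extd (wedge eta a) c x = (fun t =>
    wedge2 detax (a c x) t + - wedge1 etax (extd a c x) t).
  by apply/funext => t; rewrite extd_wedge.
rewrite !eC ks eEa contract_mxD contract_mxN.
rewrite (contract_mx_wedge1 (eta := form_row eta c x)); first last.
- by move=> i; rewrite mxE.
- exact: mul_eta_jacobi.
- exact: jacobi_mx_tr.
congr (_ - _).
rewrite (contract_mx_wedge2 (W := extd_mx eta c x) (eta := form_row eta c x)
  (E := reeb_row (extd_mx eta c x) (form_row eta c x))
  (f := etax) s (r := m%:R)) //.
- by rewrite /interior contact_vfieldE.
- exact: jacobi_mx_tr.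
- exact: mul_W_jacobi.
- by rewrite sum_jacobi_W //= mulnC muln2 -addnn natrD.
- by move=> u; rewrite (form_rowE _ _ eta1).
- by move=> i u; rewrite (extd_mxE _ _ eta1).
- exact: form_multilinear ha _ _.
- exact: form_antisymmetric ha.
Qed.

Lemma interior_wedge s :
  interior E (wedge eta a) c x s = a c x s - wedge1 etax (interior E a c x) s.
Proof.
by rewrite /interior (wedge_contactE heta _ _ _ ha) wedge1_cons
  contact_eta_reeb // mul1r.
Qed.

(** Both parts of the Lie derivative obey a Leibniz rule; the terms falling on eta add up to L_E eta
    = 0. *)
Lemma lie_wedge s : lie E (wedge eta a) c x s = wedge1 etax (lie E a c x) s.
Proof.
have -> : lie E a c x = (fun t => 'D_(E c x) (fun y => a c y t : R^o) x +
    derivation (fun v => 'D_v (E c) x) (a c x) t).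
  by apply/funext => t; rewrite lieE //.
rewrite lieE // wedge1Dr.
have -> : (fun y => wedge eta a c y s : R^o) =
    (fun y => wedge1 (fun v => eta c y [:: v]) (a c y) s).
  by apply/funext => y; rewrite (wedge_contactE heta _ _ _ ha).
have -> : wedge eta a c x = wedge1 etax (a c x).
  by apply/funext => t; rewrite (wedge_contactE heta _ _ _ ha).
have H := is_derive_wedge1 (f := fun y v => eta c y [:: v]) (a := a c) (x := x)
  (v := E c x) s (fun u => diff_derivable (form_differentiable _ eta1 cx))
  (fun t => diff_derivable (form_differentiable _ ha cx)).
rewrite [X in X + _](@derive_val _ _ _ _ _ _ _ H) derivation_wedge1.
rewrite addrACA addrC -wedge1Dl [X in _ + X]wedge1_0l ?addr0 // => u.
exact: lie_contact.
Qed.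

End AtPoint.

End Homotopy.

(** * The homotopy identity, and cycles as boundaries *)

Section Acyclicity.
Context {R : realType} {m : nat} {M : topologicalType}.
Context {A : manifold R (2 * m).+1 M} {eta : preform A}.
Hypothesis heta : contact_form m eta.
Local Notation E := (contact_vfield eta).
Local Notation L := (contact_bivector eta).
Implicit Types (a b : preform A) (z w : preform A * preform A).

Let eta1 : Omega 1 eta. Proof. by case: heta. Qed.

Definition chain_lin r z w := (form_lin r z.1 w.1, form_lin r z.2 w.2).

Lemma LJ_chain_lin k r z w :
  LJ_chain k z -> LJ_chain k w -> LJ_chain k (chain_lin r z w).
Proof. by move=> [ha hb] [ha' hb']; split; apply: Omega_lin. Qed.

Lemma LJ_d_lin k r z w : LJ_chain k z -> LJ_chain k w ->
  LJ_d L E k (chain_lin r z w) = chain_lin r (LJ_d L E k z) (LJ_d L E k w).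
Proof.
case: z w => [a b] [a' b'] [/= ha hb] [/= ha' hb'].
have d j (f : preform A) (hf : Omega j f) c x : cdom c x ->
    forall t, differentiable (fun y => f c y t : R^o) x.
  by move=> cx t; apply: form_differentiable hf cx.
have dc j (f : preform A) (hf : Omega j f) c x : cdom c x ->
    forall t, differentiable (fun y => contract L f c y t : R^o) x.
  by move=> cx t; apply: (differentiable_contract heta _ hf cx).
have ext (f f' : preform A) : (forall c x s, f c x s = f' c x s) -> f = f'.
  by move=> e; apply/funext => c; apply/funext => x; apply/funext => s.
have el j (f f' : preform A) : Omega j f -> Omega j f' ->
    extd (form_lin r f f') = form_lin r (extd f) (extd f').
  by move=> hf hf'; apply: ext => c x s; apply: extd_lin;
    [apply: d hf c x | apply: d hf' c x].
have ecl j (f f' : preform A) : Omega j f -> Omega j f' ->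
    extd (contract L (form_lin r f f')) =
    form_lin r (extd (contract L f)) (extd (contract L f')).
  move=> hf hf'; rewrite contract_lin; apply: ext => c x s.
  by apply: extd_lin; [apply: dc hf c x | apply: dc hf' c x].
rewrite /LJ_d /chain_lin /=.
congr pair; apply/funext => c; apply/funext => x; apply/funext => s.
  rewrite (el k) // (ecl k) // contract_lin lie_lin;
    first by rewrite /form_lin /interior; ring.
    exact: d hb c x.
  exact: d hb' c x.
rewrite (el (k - 1)) // (ecl (k - 1)) // !contract_lin /form_lin /interior;
  ring.
Qed.

(** The coefficient of a is (m - k) + (k + 1), that of b is (m - (k - 1)) + k. Raising the degree by
    one also flips (-1)^k, which gives the coupling terms the same minus sign as the rest of eta /\
    delta. *)
Lemma LJ_d_wedge k a b c x s : Omega k a -> Omega (k - 1) b -> cdom c x ->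
  (LJ_d L E (k + 1) (wedge eta a, wedge eta b)).1 c x s =
    m.+1%:R * a c x s -
    wedge1 (fun v => eta c x [:: v]) ((LJ_d L E k (a, b)).1 c x) s /\
  (LJ_d L E (k + 1) (wedge eta a, wedge eta b)).2 c x s =
    m.+1%:R * b c x s -
    wedge1 (fun v => eta c x [:: v]) ((LJ_d L E k (a, b)).2 c x) s.
Proof.
move=> ha hb cx; set etax := fun v => _.
have sgn : (-1) ^ (k + 1) = - (-1) ^ k :> R.
  by rewrite expfzDr ?oppr_eq0 ?oner_eq0 // expr1z mulrN1.
have k1 : (k + 1)%:~R = k%:~R + 1 :> R by rewrite intrD.
have k2 : (k + 1 - 1)%:~R = k%:~R :> R by rewrite addrK.
have k3 : (k - 1)%:~R = k%:~R - 1 :> R by rewrite intrB.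
have w1 (f g h q : seq _ -> R) (u v : R) : wedge1 etax
      (fun t => f t - g t + u * h t + v * q t) s =
    wedge1 etax f s - wedge1 etax g s + u * wedge1 etax h s +
    v * wedge1 etax q s.
  by rewrite !wedge1Dr wedge1Nr !wedge1Zr.
split; rewrite /LJ_d /= w1 sgn ?k1 ?k2.
  rewrite (contract_extd_wedge heta ha cx) (extd_contract_wedge heta ha cx).
  by rewrite (interior_wedge heta ha cx) (lie_wedge heta hb cx) -natr1; ring.
rewrite (contract_extd_wedge heta hb cx) (extd_contract_wedge heta hb cx).
rewrite (interior_wedge heta hb cx) (contract_wedge heta ha s cx) -natr1 k3.
by ring.
Qed.

Lemma chain_linN z w : chain_lin (-1) z w = w - z.
Proof.
case: z w => [a b] [a' b']; congr pair; apply/funext => c; apply/funext => x;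
  by apply/funext => s; rewrite /form_lin /= mulN1r addrC.
Qed.

Lemma LJ_chain0 k : LJ_chain k (0 : preform A * preform A).
Proof. by split; apply: Omega0. Qed.

Lemma LJ_cycle0 k : LJ_cycle L E k 0.
Proof.
split; first exact: LJ_chain0.
(* Writing 0 as 0 - 0 reduces delta 0 = 0 to linearity. *)
rewrite -[in LHS](subrr 0) -chain_linN LJ_d_lin; try exact: LJ_chain0.
by rewrite chain_linN subrr.
Qed.

Lemma LJ_cycleB k z w :
  LJ_cycle L E k z -> LJ_cycle L E k w -> LJ_cycle L E k (w - z).
Proof.
move=> [hz dz] [hw dw]; rewrite -chain_linN; split; first exact: LJ_chain_lin.
by rewrite LJ_d_lin // dz dw chain_linN subrr.
Qed.

(** Complements the homotopy identity, which is proved only on the image of a chart: outside it the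
    local expressions are zero by convention. *)
Lemma LJ_d_supp k z c x s : LJ_chain k z -> ~ cdom c x ->
  (LJ_d L E k z).1 c x s = 0 /\ (LJ_d L E k z).2 c x s = 0.
Proof.
case: z => [a b] [/= ha hb] cx.
have c0 f : (forall t, f c x t = 0) -> contract L f c x s = 0.
  by move=> f0; rewrite /contract big1 // => i _; rewrite big1 // => j _;
    rewrite f0 mulr0.
have e0 f t : extd f c x t = 0 by apply: extd_supp.
rewrite !c0 ?e0 ?lie_supp // /interior => [|t];
  last exact: form_supp ha _ _ _ cx.
by rewrite (form_supp ha) // (form_supp hb) // !mulr0 subr0 !addr0.
Qed.

Lemma LJ_cycle_boundary k z : LJ_cycle L E k z -> LJ_boundary L E k z.
Proof.
move=> [hz dz].
pose r : R := m.+1%:R^-1.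
have r1 : m.+1%:R * r = 1 by rewrite mulfV // pnatr_eq0.
case: z hz dz => [a b] hz dz; have [/= az bz] := hz; have h0 := LJ_chain0 k.
(* The cycle is divided by m + 1 before eta /\ _ is applied; by linearity of the differential it
   remains a cycle. *)
pose a' := form_lin r a 0; pose b' := form_lin r b 0.
have [ha hb] : Omega k a' /\ Omega (k - 1) b' by exact: (LJ_chain_lin r hz h0).
have dz' : LJ_d L E k (a', b') = 0.
  rewrite -[(a', b')]/(chain_lin r (a, b) 0) LJ_d_lin // dz (LJ_cycle0 k).2.
  by congr pair; apply/funext => c; apply/funext => x; apply/funext => s;
    rewrite /form_lin /= mulr0 addr0.
have hw : LJ_chain (k + 1) (wedge eta a', wedge eta b').
  split => /=; first by rewrite addrC; apply: Omega_wedge.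
  by rewrite (_ : k + 1 - 1 = 1 + (k - 1)); [apply: Omega_wedge | ring].
exists (wedge eta a', wedge eta b') => //.
have ea f : m.+1%:R * (r * f + 0) = f by rewrite addr0 mulrA r1 mul1r.
have w0 c x s f : f = 0 :> preform A -> wedge1 (fun v => eta c x [:: v]) (f c x)
  s = 0.
  by move=> ->; apply: wedge1_0r.
(* On the image of a chart the term eta /\ delta(a', b') drops out, leaving (m + 1) r = 1 times the
   cycle; elsewhere both sides are zero. *)
rewrite [LHS]surjective_pairing; congr pair;
  apply/funext => c; apply/funext => x; apply/funext => s;
  have [cx|cx] := EM (cdom c x).
- by rewrite (LJ_d_wedge s ha hb cx).1 dz' w0 // subr0 ea.
- by rewrite (LJ_d_supp s hw cx).1 (form_supp az).
- by rewrite (LJ_d_wedge s ha hb cx).2 dz' w0 // subr0 ea.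
- by rewrite (LJ_d_supp s hw cx).2 (form_supp bz).
Qed.

End Acyclicity.

Unset Implicit Arguments.

Theorem theorem4p17 (R : realType) (m : nat) (M : topologicalType)
    (A : manifold R (2 * m).+1 M) (eta : preform A)
    (heta : contact_form m eta) (k : int) :
  LJ_homology (contact_bivector eta) (contact_vfield eta) k =
  [set LJ_class (contact_bivector eta) (contact_vfield eta) k 0].
Proof.
(* Any two cycles differ by a cycle, hence by a boundary, so each class is the whole set of cycles
   and there is just one. *)
have classE z : LJ_cycle (contact_bivector eta) (contact_vfield eta) k z ->
    LJ_class (contact_bivector eta) (contact_vfield eta) k z =
    LJ_cycle (contact_bivector eta) (contact_vfield eta) k.
  move=> hz; apply/seteqP; split=> [w []//|w hw]; split=> //.
  exact/(LJ_cycle_boundary heta)/(LJ_cycleB heta).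
have h0 := LJ_cycle0 heta k.
apply/seteqP; split=> [_ [z hz <-]|_ ->] /=; first by rewrite !classE.
by exists 0.
Qed.
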